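(* Let $G$ be a VZ-group, let $\mu\in\mathrm{Irr}(Z(G)\mid G')$, let $\chi_\mu \in \mathrm{nl}(G)$ be the corresponding non-linear irreducible character, and let $N=\ker(\chi_\mu)=\ker(\mu)$. Then: (1) $e_{\mathbb{Q}}(\chi_\mu)= \epsilon(Z(G), N)$. (2) If $G$ is a VZ $p$-group with $p$ an odd prime, then $\mathbb{Q}G\,\epsilon(G, N) \cong M_{|G/Z(G)|^{1/2}}(\mathbb{Q}(\zeta_{|Z(G)/N|}))$. (3) If $G$ is a VZ $2$-group, then $\mathbb{Q}G\,\epsilon(G, N) \cong M_{|G/Z(G)|^{1/2}}(\mathbb{Q}(\zeta_{|Z(G)/N|}))$ when $m_\mathbb{Q}(\chi_{\mu})=1$, and $\mathbb{Q}G\,\epsilon(G, N) \cong M_{\frac{1}{2}|G/Z(G)|^{1/2}}(\mathbb{H}(\mathbb{Q}))$ when $m_\mathbb{Q}(\chi_{\mu})=2$.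
   Context: A finite group $G$ is a VZ-group if every non-linear irreducible complex character of $G$ vanishes on $G\setminus Z(G)$; then $G'\subseteq Z(G)$ and $|G/Z(G)|$ is a perfect square. $\mathrm{nl}(G)$ is the set of irreducible complex characters of $G$ of degree $\ne 1$, and $\mathrm{Irr}(Z(G)\mid G')=\{\mu\in\mathrm{Irr}(Z(G)) : G'\not\subseteq\ker\mu\}$. The map $\mu\mapsto\chi_\mu$, with $\chi_\mu(g)=|G/Z(G)|^{1/2}\mu(g)$ for $g\in Z(G)$ and $\chi_\mu(g)=0$ otherwise, is a bijection $\mathrm{Irr}(Z(G)\mid G')\to\mathrm{nl}(G)$. For $\chi\in\mathrm{Irr}(G)$, $e(\chi)=\frac{\chi(1)}{|G|}\sum_{g\in G}\chi(g)g^{-1}\in\mathbb{C}G$ and $e_{\mathbb{Q}}(\chi)=\sum_{\sigma\in\mathrm{Gal}(\mathbb{Q}(\chi)/\mathbb{Q})}e(\chi^\sigma)$, where $\chi^\sigma(g)=\sigma(\chi(g))$; $e_{\mathbb{Q}}(\chi)$ is a primitive central idempotent of $\mathbb{Q}G$. For a nonempty subset $X$ of a group, $\widehat{X}=\frac1{|X|}\sum_{x\in X}x$. For a finite group $K$ and $N\trianglelefteq K$, $\epsilon(K,N)=\widehat{K}$ if $K=N$, and otherwise $\epsilon(K,N)=\prod_{D/N\in M(K/N)}(\widehat{N}-\widehat{D})$, where $M(K/N)$ is the set of minimal non-trivial normal subgroups $D/N$ of $K/N$ ($N\le D\le K$). $m_{\mathbb{Q}}(\chi)$ is the Schur index of $\chi$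 over $\mathbb{Q}$, $\zeta_d$ is a primitive $d$-th root of unity, $M_n(D)$ is the $n\times n$ matrix ring over $D$, and $\mathbb{H}(\mathbb{Q})$ is the quaternion algebra over $\mathbb{Q}$ with $i^2=j^2=-1$, $ij=-ji$. *)

(* Defs.v *)
From HB Require Import structures.
From mathcomp Require Import all_boot all_order all_algebra.
From mathcomp Require Import all_fingroup all_solvable all_field all_character.
From mathcomp Require Import ring.

Set Implicit Arguments.
Unset Strict Implicit.
Unset Printing Implicit Defensive.

Import GroupScope Order.TTheory GRing.Theory Num.Theory.
Local Open Scope ring_scope.

(* The group algebra R[gT]; the group algebra RG of a subgroup G of gT is the *)
(* subring of elements supported in G (gralg_on below). The alias hides the   *)
(* pointwise ring structure of {ffun gT -> R}.                                *)
Definition gralg (R : pzRingType) (gT : finGroupType) := {ffun gT -> R}.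

HB.instance Definition _ (R : pzRingType) (gT : finGroupType) :=
  GRing.Zmodule.copy (gralg R gT) {ffun gT -> R}.

Section GroupAlgebraRing.

Variables (R : pzRingType) (gT : finGroupType).
Implicit Types x y z : gralg R gT.

Definition gbase (a : gT) : gralg R gT := [ffun g => (g == a)%:R].

Definition gmul x y : gralg R gT := [ffun g => \sum_h x h * y (h^-1 * g)%g].

Fact gmulA : associative gmul.
Proof.
move=> x y z; apply/ffunP=> g; rewrite !ffunE.
under eq_bigr => h _ do rewrite ffunE big_distrr /=.
under [RHS]eq_bigr => h _ do rewrite ffunE big_distrl /=.
rewrite [RHS]exchange_big /=; apply: eq_bigr => h _.
rewrite [RHS](reindex_inj (mulgI h)) /=; apply: eq_bigr => k _.
by rewrite mulrA mulKg invMg mulgA.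
Qed.

Fact gmul1l : left_id (gbase 1%g) gmul.
Proof.
move=> x; apply/ffunP=> g; rewrite ffunE (bigD1 1%g) //= ffunE eqxx mul1r.
rewrite invg1 mul1g big1 ?addr0 // => h /negbTE h1.
by rewrite ffunE h1 mul0r.
Qed.

Fact gmul1r : right_id (gbase 1%g) gmul.
Proof.
move=> x; apply/ffunP=> g; rewrite ffunE (bigD1 g) //= ffunE mulVg eqxx mulr1.
rewrite big1 ?addr0 // => h /negbTE hg.
by rewrite ffunE -eq_mulVg1 hg mulr0.
Qed.

Fact gmulDl : left_distributive gmul +%R.
Proof.
move=> x y z; apply/ffunP=> g; rewrite !ffunE -big_split /=.
by apply: eq_bigr => h _; rewrite ffunE mulrDl.
Qed.

Fact gmulDr : right_distributive gmul +%R.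
Proof.
move=> x y z; apply/ffunP=> g; rewrite !ffunE -big_split /=.
by apply: eq_bigr => h _; rewrite ffunE mulrDr.
Qed.

HB.instance Definition _ := GRing.Zmodule_isPzRing.Build (gralg R gT)
  gmulA gmul1l gmul1r gmulDl gmulDr.

Definition gscale (a : R) x : gralg R gT := [ffun g => a * x g].

Fact gscaleA a b x : gscale a (gscale b x) = gscale (a * b) x.
Proof. by apply/ffunP=> g; rewrite !ffunE mulrA. Qed.

Fact gscale1 : left_id 1 gscale.
Proof. by move=> x; apply/ffunP=> g; rewrite !ffunE mul1r. Qed.

Fact gscaleDr : right_distributive gscale +%R.
Proof. by move=> a x y; apply/ffunP=> g; rewrite !ffunE mulrDr. Qed.

Fact gscaleDl x : {morph gscale^~ x : a b / a + b}.
Proof. by move=> a b; apply/ffunP=> g; rewrite !ffunE mulrDl. Qed.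

HB.instance Definition _ := GRing.Zmodule_isLmodule.Build R (gralg R gT)
  gscaleA gscale1 gscaleDr gscaleDl.

End GroupAlgebraRing.

Definition gralg_on (R : pzRingType) (gT : finGroupType) (G : {set gT}) :
    {pred gralg R gT} :=
  [pred x : gralg R gT | [forall g, (g \notin G) ==> (x g == 0)]].

(* The inclusion of QG into CG. *)
Definition gralgQC (gT : finGroupType) (x : gralg rat gT) : gralg algC gT :=
  [ffun g => ratr (x g)].

Definition hat (F : fieldType) (gT : finGroupType) (X : {set gT}) :
    gralg F gT :=
  #|X|%:R^-1 *: \sum_(g in X) gbase F g.

(* M(K/N) is indexed by the subgroups D of K containing N; for N normal in K  *)
(* the factors commute, so that the order of the product is irrelevant.       *)
Definition epsilon (F : fieldType) (gT : finGroupType) (K N : {group gT}) :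
    gralg F gT :=
  if K :==: N then hat F K
  else \prod_(D : {group gT} |
                [&& N \subset D, D \subset K & minnormal (D / N) (K / N)])
         (hat F N - hat F D).

Definition nl (gT : finGroupType) (G : {group gT}) : {set Iirr G} :=
  [set i | 'chi_i 1%g != 1].

Definition VZ_group (gT : finGroupType) (G : {group gT}) : Prop :=
  forall i : Iirr G, i \in nl G ->
    forall g : gT, g \in G :\: 'Z(G) -> 'chi_i g = 0.

Definition Irr_over (gT : finGroupType) (Z H : {group gT}) : {set Iirr Z} :=
  [set j | ~~ (H \subset cfker 'chi_j)].

Definition chi_of (gT : finGroupType) (G : {group gT}) (mu : Iirr 'Z(G)) :
    gT -> algC :=
  fun g => if g \in 'Z(G) then sqrtC #|(G / 'Z(G))%g|%:R * 'chi_mu g else 0.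

Definition pcidem (gT : finGroupType) (G : {group gT}) (chi : gT -> algC) :
    gralg algC gT :=
  (chi 1%g / #|G|%:R) *: \sum_(g in G) chi g *: gbase algC g^-1%g.

(* group_num_field_exists G provides a number field Qn with an embedding QnC  *)
(* in algC whose image contains the values of every character of G. For g in  *)
(* G, chiQ g is the element of Qn mapped to 'chi_i g by QnC.                  *)
Definition pcidemQ (gT : finGroupType) (G : {group gT}) (i : Iirr G) :
    gralg algC gT :=
  let: existT2 Qn _ (existT2 QnC _ (existT2 _ _ Qn_val)) :=
    group_num_field_exists G in
  let chiQ g : Qn :=
    if insub g is Some u
    then sval (Qn_val gT G 'chi_i (irr_char i) _ (order_dvdG (subgP u)))
    else 0 in
  let Qchi : {subfield Qn} := <<1 & [seq chiQ g | g in G]>>%AS in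
  \sum_(s in 'Gal(Qchi / 1)%g) pcidem G (fun g => QnC (s (chiQ g))).

(* The Schur index of chi over Q is the multiplicity of chi in an irreducible *)
(* rational representation, extended to C, that has chi as a constituent;     *)
(* such a representation exists and is unique up to isomorphism.              *)
Definition is_schur_indexQ (gT : finGroupType) (G : {group gT}) (i : Iirr G)
    (m : nat) : Prop :=
  exists (n : nat) (rG : mx_representation rat G n),
    let psi := cfRepr (map_repr (ratr : rat -> algC) rG) in
    [/\ mx_irreducible rG, i \in irr_constt psi & '[psi, 'chi_i] = m%:R].

(* The field Q(zeta_d), for d > 0. *)
Definition cyclotomic_field (d : nat) : fieldExtType rat :=
  projT1 (num_field_exists [:: sval (C_prim_root_exists (ltn0Sn d.-1))]).

Lemma cyclotomic_fieldP (d : nat) : (0 < d)%N ->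
  exists2 z : cyclotomic_field d, d.-primitive_root z & <<1; z>>%VS = fullv.
Proof.
case: d => // d _; rewrite /cyclotomic_field.
case: (C_prim_root_exists _) => /= w prim_w.
case: (num_field_exists _) => L [LC [[|z []] //= [Dz] genL]].
exists z; first by rewrite -Dz fmorph_primitive_root in prim_w.
by rewrite -genL span_seq1.
Qed.

(* (a, b, c, d) stands for a + b i + c j + d k. *)
Definition quatQ : Type := (rat * rat * rat * rat)%type.

HB.instance Definition _ := GRing.Zmodule.copy quatQ (rat * rat * rat * rat)%type.

Definition quat_one : quatQ := (1, 0, 0, 0).

Definition quat_mul (x y : quatQ) : quatQ :=
  let: (a1, b1, c1, d1) := x in
  let: (a2, b2, c2, d2) := y in
  (a1 * a2 - b1 * b2 - c1 * c2 - d1 * d2,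
   a1 * b2 + b1 * a2 + c1 * d2 - d1 * c2,
   a1 * c2 - b1 * d2 + c1 * a2 + d1 * b2,
   a1 * d2 + b1 * c2 - c1 * b2 + d1 * a2).

Fact quat_mulA : associative quat_mul.
Proof.
case=> [[[a1 b1] c1] d1] [[[a2 b2] c2] d2] [[[a3 b3] c3] d3] /=.
by congr (_, _, _, _); ring.
Qed.

Fact quat_mul1l : left_id quat_one quat_mul.
Proof. by case=> [[[a b] c] d] /=; congr (_, _, _, _); ring. Qed.

Fact quat_mul1r : right_id quat_one quat_mul.
Proof. by case=> [[[a b] c] d] /=; congr (_, _, _, _); ring. Qed.

Fact quat_addE (a1 b1 c1 d1 a2 b2 c2 d2 : rat) :
  ((a1, b1, c1, d1) : quatQ) + (a2, b2, c2, d2) =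
  (a1 + a2, b1 + b2, c1 + c2, d1 + d2).
Proof. by []. Qed.

Fact quat_mulDl : left_distributive quat_mul +%R.
Proof.
case=> [[[a1 b1] c1] d1] [[[a2 b2] c2] d2] [[[a3 b3] c3] d3].
by rewrite /= !quat_addE /=; congr (_, _, _, _); ring.
Qed.

Fact quat_mulDr : right_distributive quat_mul +%R.
Proof.
case=> [[[a1 b1] c1] d1] [[[a2 b2] c2] d2] [[[a3 b3] c3] d3].
by rewrite /= !quat_addE /=; congr (_, _, _, _); ring.
Qed.

Fact quat_one_neq0 : quat_one != 0.
Proof. by []. Qed.

HB.instance Definition _ := GRing.Zmodule_isNzRing.Build quatQ
  quat_mulA quat_mul1l quat_mul1r quat_mulDl quat_mulDr quat_one_neq0.

(* The ring (QG) e, with identity element e, is isomorphic to B: f is the     *)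
(* isomorphism from B, viewed as a map to the group algebra.                  *)
Definition QG_component_iso (gT : finGroupType) (G : {group gT})
    (e : gralg rat gT) (B : pzRingType) : Prop :=
  exists f : {additive B -> gralg rat gT},
    [/\ injective f,
        {morph f : a b / a * b},
        f 1 = e
      & forall x, (exists a, f a = x) <->
                  (exists2 y, y \in gralg_on G & x = y * e)].

(* Main.v *)
From HB Require Import structures.
Require Import Defs.
From mathcomp Require Import all_boot all_order all_algebra.
From mathcomp Require Import all_fingroup all_solvable all_field all_character.
From mathcomp Require Import ring.

Set Implicit Arguments.
Unset Strict Implicit.
Unset Printing Implicit Defensive.

Import GroupScope Order.TTheory GRing.Theory Num.Theory.
Local Open Scope ring_scope.

(** Let [Z] be the center of [G] and [N] the common kernel of [mu] and of the
    character [chi] that is fully ramified over [mu]. Elements of the complex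
    group algebra of [Z] are determined by their values at the linear characters
    of [Z]. At a character [nu] both the rational idempotent of [chi] and
    [e = epsilon Z N] take the value one if [nu] has kernel [N] and zero
    otherwise: for the former because two characters with the same kernel are
    Galois conjugate ([cfker_conjugate]), for the latter by [gev_epsilon]. This
    is the first equality ([pcidemQ_epsilon]).

    For a [p]-group, minimal normal subgroups of [G / N] are central, so that
    [epsilon G N = e]. The VZ property puts the derived subgroup inside [Z], and
    the pairing [mu [~ x, g]] is nondegenerate on [G / Z]. Let [Y] be maximal
    among the subgroups that contain [N] and meet [Z] in [N], let [C] be its
    orthogonal for the pairing, and let [f] be [e] times the average of [Y]. The
    conjugates of [f] are orthogonal, indexed by [G / C], and their sum is [e];
    they provide matrix units, so that the component of [e] is the ring of
    matrices of size [#|G : C|] over the corner ring [QC f]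
    ([isotropic_component_iso]).

    Maximality of [Y] means that every subgroup of order [p] of [C / Y] lies in
    the image of [Z], which is cyclic. A [p]-group with a single subgroup of
    order [p] is cyclic or generalized quaternion, and a generalized quaternion
    group of class two has order eight. In the cyclic case [C = Y Z], and the
    corner ring is that of [Z], namely the field of values of [mu]
    ([cyclotomic_component]). In the quaternion case [p = 2], [Z / N] has
    order two, and the corner ring is the quaternion algebra
    ([quaternion_component_iso]).

    The Schur index tells the two cases apart. Consider an irreducible rational
    representation in which [chi] has multiplicity [m], and the product of [f]
    and the complex idempotent of [chi]. A trace computation gives its rank: [m]
    in the cyclic case and [2 * m] in the quaternion case. In the cyclic case
    the rank is at most one, since the representation is generated by one vector
    fixed by [f] ([schur_index_split]); in the quaternion case it is at least
    four, since the quaternions act freely on the rational vectors fixed by [f]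
    ([schur_index_quaternion]). *)

(** * The group algebra *)

Section GroupAlgebra.

Variables (F : fieldType) (gT : finGroupType).
Implicit Types (x y : gralg F gT) (a b g : gT) (H : {group gT}).

Local Notation "g %:g" := (gbase F g) (at level 2, format "g %:g").

Lemma gbase_mulE a x g : (a%:g * x) g = x (a^-1 * g)%g.
Proof.
rewrite ffunE (bigD1 a) //= ffunE eqxx mul1r big1 ?addr0 // => h /negbTE ha.
by rewrite ffunE ha mul0r.
Qed.

Lemma gbaseM a b : (a * b)%g%:g = a%:g * b%:g.
Proof.
by apply/ffunP=> g; rewrite gbase_mulE !ffunE (canF_eq (mulKVg a)).
Qed.

Lemma gbase1 : gbase F 1%g = 1 :> gralg F gT. Proof. by []. Qed.

Lemma gscalerAl (c : F) x y : c *: (x * y) = (c *: x) * y.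
Proof.
apply/ffunP=> g; rewrite !ffunE big_distrr; apply: eq_bigr => h _ /=.
by rewrite ffunE mulrA.
Qed.

Lemma gscalerAr (c : F) x y : c *: (x * y) = x * (c *: y).
Proof.
apply/ffunP=> g; rewrite !ffunE big_distrr; apply: eq_bigr => h _ /=.
by rewrite ffunE mulrCA.
Qed.

Lemma gralg_onP (A : {set gT}) x :
  reflect (forall g, g \notin A -> x g = 0) (x \in gralg_on A).
Proof.
apply: (iffP forallP) => x0 g; last by apply/implyP=> /x0/eqP.
by move=> Ag; apply/eqP; exact: (implyP (x0 g)).
Qed.

Lemma gralg_on_sum (A : {set gT}) x : x \in gralg_on A ->
  x = \sum_(g in A) x g *: g%:g.
Proof.
move/gralg_onP=> x0; apply/ffunP=> h; rewrite sum_ffunE.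
have [Ah | A'h] := boolP (h \in A); last first.
  rewrite x0 // big1 // => g Ag; rewrite !ffunE.
  by case: eqP => [Dh | _]; [rewrite Dh Ag in A'h | rewrite mulr0].
rewrite (bigD1 h) //= !ffunE eqxx mulr1 big1 ?addr0 // => g /andP[_ /negbTE gh].
by rewrite !ffunE eq_sym gh mulr0.
Qed.

Lemma gralg_on_base (A : {set gT}) g : g \in A -> g%:g \in gralg_on A.
Proof.
move=> Ag; apply/gralg_onP=> h; rewrite ffunE; case: eqP => // -> /negP[] //.
Qed.

Lemma gralg_onZ (A : {set gT}) c x :
  x \in gralg_on A -> c *: x \in gralg_on A.
Proof.
move/gralg_onP=> x0; apply/gralg_onP=> g /x0.
by rewrite ffunE => ->; rewrite mulr0.
Qed.

Lemma gralg_onD (A : {set gT}) x y :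
  x \in gralg_on A -> y \in gralg_on A -> x + y \in gralg_on A.
Proof.
move=> /gralg_onP x0 /gralg_onP y0; apply/gralg_onP=> g Ag.
by rewrite ffunE x0 ?y0 ?addr0.
Qed.

Lemma gralg_onN (A : {set gT}) x :
  x \in gralg_on A -> - x \in gralg_on A.
Proof. by rewrite -scaleN1r; apply: gralg_onZ. Qed.

Lemma gralg_on0 (A : {set gT}) : (0 : gralg F gT) \in gralg_on A.
Proof. by apply/gralg_onP=> g _; rewrite ffunE. Qed.

Lemma gralg_on_bigsum (A : {set gT}) I (r : seq I) (P : pred I)
    (E : I -> gralg F gT) :
  (forall i, P i -> E i \in gralg_on A) ->
  \sum_(i <- r | P i) E i \in gralg_on A.
Proof.
move=> AE; elim/big_rec: _ => [|i x /AE]; first exact: gralg_on0.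
exact: gralg_onD.
Qed.

Lemma gralg_onM H x y :
  x \in gralg_on H -> y \in gralg_on H -> x * y \in gralg_on H.
Proof.
move=> Hx Hy; rewrite (gralg_on_sum Hx) (gralg_on_sum Hy) mulr_suml.
apply: gralg_on_bigsum => g Hg; rewrite mulr_sumr.
apply: gralg_on_bigsum => h Hh; rewrite -gscalerAl -gscalerAr -gbaseM.
by do 2!apply: gralg_onZ; rewrite gralg_on_base ?groupM.
Qed.

Lemma gralg_onS (A B : {set gT}) x :
  A \subset B -> x \in gralg_on A -> x \in gralg_on B.
Proof.
move=> sAB /gralg_onP x0; apply/gralg_onP=> g B'g; apply: x0.
by apply: contra B'g; apply: subsetP.
Qed.

Lemma gralg_on_prod H I (r : seq I) (P : pred I) (E : I -> gralg F gT) :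
  (forall i, P i -> E i \in gralg_on H) ->
  \prod_(i <- r | P i) E i \in gralg_on H.
Proof.
move=> HE; elim/big_rec: _ => [|i x /HE]; last exact: gralg_onM.
by rewrite -gbase1 gralg_on_base.
Qed.

Lemma gralg_on_hat (A : {set gT}) : (hat F A : gralg F gT) \in gralg_on A.
Proof. by apply/gralg_onZ/gralg_on_bigsum => g; apply: gralg_on_base. Qed.

Lemma gbase_commute_on (A : {set gT}) x g :
    (forall a, a \in A -> commute a g) -> x \in gralg_on A ->
  g%:g * x = x * g%:g.
Proof.
move=> cAg /gralg_on_sum->; rewrite mulr_sumr mulr_suml.
by apply: eq_bigr => a /cAg cag; rewrite -gscalerAr -gscalerAl -!gbaseM cag.
Qed.

Lemma gralg_on_commute (A : {set gT}) x y :
    {in A, forall g, g%:g * y = y * g%:g} -> x \in gralg_on A -> x * y = y * x.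
Proof.
move=> cAy /gralg_on_sum->; rewrite mulr_sumr mulr_suml.
by apply: eq_bigr => g /cAy cgy; rewrite -(gscalerAl _ _ y) -(gscalerAr _ y) cgy.
Qed.

Lemma gbase_hat H g : g \in H -> g%:g * hat F H = hat F H.
Proof.
move=> Hg; rewrite -gscalerAr mulr_sumr; congr (_ *: _).
rewrite [RHS](reindex_inj (mulgI g)) /=; apply: eq_big => [h | h _].
  by rewrite groupMl.
by rewrite gbaseM.
Qed.

Lemma hat_gbase H g : g \in H -> hat F H * g%:g = hat F H.
Proof.
move=> Hg; rewrite -gscalerAl mulr_suml; congr (_ *: _).
rewrite [RHS](reindex_inj (mulIg g)) /=; apply: eq_big => [h | h _].
  by rewrite groupMr.
by rewrite gbaseM.
Qed.

Lemma hat_fix H x : #|H|%:R != 0 :> F ->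
  {in H, forall h, h%:g * x = x} -> hat F H * x = x.
Proof.
move=> nzH fixx; rewrite -gscalerAl mulr_suml (eq_bigr _ fixx) sumr_const.
by rewrite -scaler_nat scalerA mulVf ?scale1r.
Qed.

Definition gev (A : {set gT}) (nu : gT -> F) x := \sum_(g in A) x g * nu g.

Fact gev_zmod_morphism A nu : zmod_morphism (gev A nu).
Proof.
by move=> x y; rewrite /gev -sumrB; apply: eq_bigr => g _; rewrite !ffunE mulrBl.
Qed.

HB.instance Definition _ A nu :=
  GRing.isZmodMorphism.Build _ _ (gev A nu) (gev_zmod_morphism A nu).

Lemma gevZ A nu c x : gev A nu (c *: x) = c * gev A nu x.
Proof. by rewrite mulr_sumr; apply: eq_bigr => g _; rewrite ffunE mulrA. Qed.

Lemma gev_base (A : {set gT}) nu g : g \in A -> gev A nu g%:g = nu g.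
Proof.
move=> Ag; rewrite /gev (bigD1 g) //= ffunE eqxx mul1r big1 ?addr0 //.
by move=> h /andP[_ /negbTE hg]; rewrite ffunE hg mul0r.
Qed.

Lemma gevM H nu x y : {in H &, {morph nu : g h / (g * h)%g >-> g * h}} ->
    x \in gralg_on H -> y \in gralg_on H ->
  gev H nu (x * y) = gev H nu x * gev H nu y.
Proof.
move=> nuM Hx Hy; rewrite {1}(gralg_on_sum Hx) {1}(gralg_on_sum Hy).
rewrite mulr_suml raddf_sum [gev H nu x]/gev mulr_suml; apply: eq_bigr => g Hg.
rewrite /= -gscalerAl gevZ -mulrA; congr (_ * _).
rewrite mulr_sumr raddf_sum [gev H nu y]/gev mulr_sumr; apply: eq_bigr => h Hh.
by rewrite /= -gscalerAr gevZ -gbaseM gev_base ?groupM // nuM // mulrCA.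
Qed.

Definition grho (G : {group gT}) n (rG : mx_representation F G n) x : 'M[F]_n :=
  \sum_(g in G) x g *: rG g.

Section Rho.

Variables (G : {group gT}) (n : nat) (rG : mx_representation F G n).

Fact grho_zmod_morphism : zmod_morphism (grho rG).
Proof.
by move=> x y; rewrite /grho -sumrB; apply: eq_bigr => g _; rewrite !ffunE scalerBl.
Qed.

HB.instance Definition _ :=
  GRing.isZmodMorphism.Build _ _ (grho rG) grho_zmod_morphism.

Lemma grhoZ c x : grho rG (c *: x) = c *: grho rG x.
Proof. by rewrite scaler_sumr; apply: eq_bigr => g _; rewrite ffunE scalerA. Qed.

Lemma grho_base g : g \in G -> grho rG g%:g = rG g.
Proof.
move=> Gg; rewrite /grho (bigD1 g) //= ffunE eqxx scale1r big1 ?addr0 //.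
by move=> h /andP[_ /negbTE hg]; rewrite ffunE hg scale0r.
Qed.

Lemma grhoM x y : x \in gralg_on G -> y \in gralg_on G ->
  grho rG (x * y) = grho rG x *m grho rG y.
Proof.
move=> Gx Gy; rewrite {1}(gralg_on_sum Gx) {1}(gralg_on_sum Gy).
rewrite mulr_suml raddf_sum [grho rG x]/grho mulmx_suml; apply: eq_bigr => g Gg.
rewrite /= -gscalerAl grhoZ -scalemxAl; congr (_ *: _).
rewrite mulr_sumr raddf_sum [grho rG y]/grho mulmx_sumr; apply: eq_bigr => h Gh.
by rewrite /= -gscalerAr grhoZ -gbaseM grho_base ?groupM // repr_mxM // -scalemxAr.
Qed.

End Rho.

End GroupAlgebra.

Section RationalGroupAlgebra.

Variable gT : finGroupType.
Implicit Types x y : gralg rat gT.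

Fact gralgQC_zmod_morphism : zmod_morphism (@gralgQC gT).
Proof. by move=> x y; apply/ffunP=> g; rewrite !ffunE rmorphB. Qed.

Fact gralgQC_monoid_morphism : monoid_morphism (@gralgQC gT).
Proof.
split=> [|x y]; apply/ffunP=> g; rewrite !ffunE ?rmorph_nat //.
by rewrite rmorph_sum; apply: eq_bigr => h _; rewrite !ffunE rmorphM.
Qed.

HB.instance Definition _ := GRing.isZmodMorphism.Build _ _ (@gralgQC gT)
  gralgQC_zmod_morphism.
HB.instance Definition _ := GRing.isMonoidMorphism.Build _ _ (@gralgQC gT)
  gralgQC_monoid_morphism.

Lemma gralgQC_base (g : gT) : gralgQC (gbase rat g) = gbase algC g.
Proof. by apply/ffunP=> h; rewrite !ffunE rmorph_nat. Qed.

Lemma gralgQCZ c x : gralgQC (c *: x) = ratr c *: gralgQC x.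
Proof. by apply/ffunP=> h; rewrite !ffunE rmorphM. Qed.

Lemma gralgQC_inj : injective (@gralgQC gT).
Proof.
move=> x y /ffunP eqxy; apply/ffunP=> g; have:= eqxy g; rewrite !ffunE.
exact: fmorph_inj.
Qed.

Lemma gralgQC_on (A : {set gT}) x :
  x \in gralg_on A -> gralgQC x \in gralg_on A.
Proof.
move/gralg_onP=> x0; apply/gralg_onP=> g /x0.
by rewrite ffunE => ->; rewrite rmorph0.
Qed.

Lemma gralgQC_hat (A : {set gT}) : gralgQC (hat rat A) = hat algC A.
Proof.
rewrite gralgQCZ fmorphV rmorph_nat rmorph_sum; congr (_ *: _).
by apply: eq_bigr => g _; apply: gralgQC_base.
Qed.

Lemma gralgQC_epsilon (K N : {group gT}) :
  gralgQC (epsilon rat K N) = epsilon algC K N.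
Proof.
rewrite /epsilon (fun_if (@gralgQC gT)) gralgQC_hat rmorph_prod.
by under eq_bigr do rewrite rmorphB /= !gralgQC_hat.
Qed.

Lemma grho_gralgQC (G : {group gT}) n (rG : mx_representation rat G n) x :
  grho (map_repr (ratr : rat -> algC) rG) (gralgQC x) =
    map_mx (ratr : rat -> algC) (grho rG x).
Proof.
rewrite /grho rmorph_sum; apply: eq_bigr => g _.
by rewrite ffunE /= map_mxZ.
Qed.

End RationalGroupAlgebra.

(** * Central elements of the complex group algebra and their characters *)

Section AbelianCharacters.

Variables (gT : finGroupType) (Z : {group gT}).
Hypothesis abelZ : abelian Z.
Implicit Types (j l : Iirr Z) (x y : gralg algC gT) (N : {group gT}).

Lemma abel_lin j : 'chi_j \is a linear_char.
Proof. exact/char_abelianP. Qed.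

Lemma gev_irrM j x y : x \in gralg_on Z -> y \in gralg_on Z ->
  gev Z 'chi_j (x * y) = gev Z 'chi_j x * gev Z 'chi_j y.
Proof. by apply: gevM => g h Zg Zh; rewrite /= lin_charM ?abel_lin. Qed.

(** Fourier inversion: by second orthogonality, the sum of the values at all
    the characters, weighted by their conjugates at [h], is [#|Z| * x h]. *)
Lemma gev_irr_inj x : x \in gralg_on Z -> (forall j, gev Z 'chi_j x = 0) -> x = 0.
Proof.
move=> Zx x0; apply/ffunP=> h; rewrite [RHS]ffunE.
have [Zh | /(gralg_onP _ _ Zx)//] := boolP (h \in Z).
have: \sum_(j : Iirr Z) gev Z (fun_of_cfun 'chi_j) x * ('chi_j h)^* = 0.
  by rewrite big1 // => j _; rewrite x0 mul0r.
under eq_bigr do rewrite /gev mulr_suml.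
rewrite exchange_big /= (bigD1 h) //= [X in _ + X]big1 ?addr0.
  under eq_bigr do rewrite -mulrA.
  rewrite -mulr_sumr second_orthogonality_relation // class_refl => /eqP.
  by rewrite mulf_eq0 pnatr_eq0 eqn0Ngt cardG_gt0 orbF => /eqP.
move=> g /andP[Zg gh]; under eq_bigr do rewrite -mulrA.
rewrite -mulr_sumr second_orthogonality_relation //.
by rewrite (abelian_classP _ abelZ) // inE (negPf gh) mulr0n mulr0.
Qed.

Lemma gev_irr_ext x y : x \in gralg_on Z -> y \in gralg_on Z ->
  (forall j, gev Z 'chi_j x = gev Z 'chi_j y) -> x = y.
Proof.
move=> Zx Zy eqxy; apply/eqP; rewrite -subr_eq0; apply/eqP.
apply: gev_irr_inj => [|j]; first by rewrite gralg_onD ?gralg_onN.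
by rewrite raddfB /= eqxy subrr.
Qed.

Lemma mem_cfker_lin j z : z \in Z -> (z \in cfker 'chi_j) = ('chi_j z == 1).
Proof. by move=> Zz; rewrite cfkerEirr inE (lin_char1 (abel_lin j)). Qed.

Lemma sum_multiplicative (H : {group gT}) (f : gT -> algC) :
    {in H &, {morph f : a b / (a * b)%g >-> a * b}} -> f 1%g = 1 ->
  \sum_(h in H) f h = if [forall h in H, f h == 1] then #|H|%:R else 0.
Proof.
move=> fM f1; case: ifP => [/forall_inP fH | /negbT].
  by rewrite (eq_bigr (fun=> 1)) ?sumr_const // => h /fH/eqP.
rewrite negb_forall_in => /exists_inP[a Ha fa]; apply/eqP.
have: (1 - f a) * \sum_(h in H) f h == 0.
  rewrite mulrBl mul1r subr_eq0 mulr_sumr (reindex_inj (mulgI a)) /=.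
  by apply/eqP/eq_big => h; rewrite groupMl // => Hh; rewrite fM.
by rewrite mulf_eq0 subr_eq0 eq_sym (negPf fa).
Qed.

Lemma gev_hat j (H : {group gT}) : H \subset Z ->
  gev Z 'chi_j (hat algC H) = (H \subset cfker 'chi_j)%:R.
Proof.
move=> sHZ; rewrite gevZ raddf_sum /=.
rewrite (eq_bigr 'chi_j) => [|h Hh]; last by rewrite gev_base // (subsetP sHZ).
rewrite sum_multiplicative => [|a b Ha Hb /=|]; last 2 first.
- by rewrite lin_charM ?abel_lin ?(subsetP sHZ).
- by rewrite lin_char1 ?abel_lin.
have ->: [forall h in H, 'chi_j h == 1] = (H \subset cfker 'chi_j).
  apply/forall_inP/subsetP => kerH h Hh.
    by rewrite mem_cfker_lin ?(subsetP sHZ) // kerH.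
  by rewrite -mem_cfker_lin ?kerH ?(subsetP sHZ).
by case: ifP; rewrite ?mulr0 // mulVf // pnatr_eq0 -lt0n.
Qed.

Lemma gralg_on_epsilon N : N \subset Z -> (epsilon algC Z N) \in gralg_on Z.
Proof.
move=> sNZ; rewrite /epsilon; case: ifP => _; first exact: gralg_on_hat.
apply: gralg_on_prod => D /and3P[_ sDZ _].
by rewrite gralg_onD ?gralg_onN // (gralg_onS _ (gralg_on_hat _ _)).
Qed.

(** At a character whose kernel contains [N], the factor of [D] is zero if [D]
    lies in the kernel and one otherwise; a kernel that is larger than [N]
    contains some minimal [D]. If the kernel does not contain [N], every factor
    is zero, and there is one because [N] differs from [Z]. *)
Lemma gev_epsilon j N : N \subset Z ->
  gev Z 'chi_j (epsilon algC Z N) = (cfker 'chi_j == N)%:R.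
Proof.
move=> sNZ; have nNZ := sub_abelian_norm abelZ sNZ.
have nsNZ: N <| Z by apply/andP.
have sKZ := cfker_sub 'chi_j.
rewrite /epsilon; case: eqP => [ZN | /eqP neqZN].
  by rewrite gev_hat // -ZN eqEsubset sKZ.
pose P (D : {group gT}) :=
  [&& N \subset D, D \subset Z & minnormal (D / N) (Z / N)].
transitivity (\prod_(D | P D)
   ((N \subset cfker 'chi_j)%:R - (D \subset cfker 'chi_j)%:R : algC)).
  pose prodD : gralg algC gT := \prod_(D | P D) (hat algC N - hat algC D).
  have: prodD \in gralg_on Z /\ gev Z 'chi_j prodD = \prod_(D | P D)
      ((N \subset cfker 'chi_j)%:R - (D \subset cfker 'chi_j)%:R).
    rewrite /prodD; elim/big_rec2: _ => [|D y1 y2 /and3P[_ sDZ _] [Zy2 gy2]].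
      by rewrite -gbase1 gralg_on_base // gev_base // lin_char1 ?abel_lin.
    have ZND: hat algC N - hat algC D \in gralg_on Z.
      by rewrite gralg_onD ?gralg_onN // (gralg_onS _ (gralg_on_hat _ _)).
    by rewrite gralg_onM // gev_irrM // gy2 raddfB /= !gev_hat.
  by case.
have minD (B : {group gT}) : N \proper B -> B \subset Z ->
    exists2 D, P D & D \subset B.
  move=> ltNB sBZ; have [sNB _] := andP ltNB.
  have [| |M minM sMB] := @minnormal_exists _ (Z / N)%G (B / N)%G.
  - rewrite -subG1 quotient_sub1 ?(subset_trans sBZ nNZ) //.
    by case/andP: ltNB.
  - exact/sub_abelian_norm/quotientS/sBZ/quotient_abelian.
  have [D defM sND sDB] := inv_quotientS (normalS sNB sBZ nsNZ) sMB.
  exists D => //; rewrite /P sND (subset_trans sDB) //=.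
  by rewrite -defM.
have [sNK | not_sNK] := boolP (N \subset cfker 'chi_j); last first.
  have [|D PD _] := minD Z _ (subxx _); first by rewrite properEneq eq_sym neqZN.
  rewrite (bigD1 D) //= (negPf (contra (subset_trans _) not_sNK)); last first.
    by case/andP: PD.
  rewrite subrr mul0r; case: eqP => // defK; case/negP: not_sNK.
  by rewrite defK.
have [eqKN | neqKN] := eqVneq (cfker 'chi_j) N.
  rewrite big1 // => D /and3P[sND sDZ /mingroupP[]].
  rewrite eqKN; case/andP => ntD _ _; case sDN: (D \subset N); last by rewrite subr0.
  by rewrite -subG1 quotient_sub1 ?sDN ?(subset_trans sDZ nNZ) in ntD.
have [|D PD sDK] := minD [group of cfker 'chi_j] _ sKZ.
  by rewrite properEneq eq_sym neqKN.
by rewrite (bigD1 D) //= sDK subrr mul0r.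
Qed.

(** The linear characters with a given kernel are the faithful characters of
    the same cyclic quotient, so that one generator of it serves them all. *)
Lemma cfker_generator j :
  exists z1, [/\ z1 \in Z,
    {in Z, forall z, exists i, forall l, cfker 'chi_l = cfker 'chi_j ->
       'chi_l z = 'chi_l z1 ^+ i}
  & forall l, cfker 'chi_l = cfker 'chi_j ->
      #|(Z / cfker 'chi_j)%g|.-primitive_root ('chi_l z1)].
Proof.
set N := cfker 'chi_j.
have defZ: 'Z('chi_j)%CF = Z.
  apply/eqP; rewrite eqEsubset cfcenter_sub; apply/subsetP=> z Zz.
  by rewrite irr_cfcenterE // normC_lin_char ?lin_char1 ?abel_lin.
have nNZ: Z \subset 'N(N) by case/andP: (cfker_normal 'chi_j).
have:= cfcenter_cyclic 'chi_j; rewrite defZ -/N => /cyclicP[w defw].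
have: w \in (Z / N)%g by rewrite defw cycle_id.
case/morphimP=> z1 Nz1 Zz1 Dw; exists z1.
have kerX l i : cfker 'chi_l = N -> ('chi_l z1 ^+ i == 1) = (#[w]%g %| i)%N.
  move=> kerl; have Zz1i: (z1 ^+ i)%g \in Z := groupX i Zz1.
  rewrite -lin_charX ?abel_lin // -mem_cfker_lin // kerl.
  rewrite order_dvdn Dw -morphX //; apply/idP/eqP=> [|cz]; first exact: coset_id.
  by apply: coset_idr cz; rewrite groupX.
split=> // [z Zz | l kerl].
  have: coset N z \in <[w]>%g by rewrite -defw mem_quotient.
  case/cycleP=> i Dz; exists i => l kerl.
  have: (z * z1 ^- i)%g \in N.
    apply: coset_idr; first by rewrite groupM ?groupV ?groupX // (subsetP nNZ).
    rewrite morphM ?groupV ?groupX ?(subsetP nNZ) //=.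
    by rewrite morphV ?groupX //= morphX //= Dz Dw mulgV.
  have Zzi: (z * z1 ^- i)%g \in Z by rewrite groupM ?groupV ?groupX.
  rewrite -kerl mem_cfker_lin // => /eqP Dzi.
  have ->: z = (z * z1 ^- i * z1 ^+ i)%g by rewrite mulgKV.
  by rewrite lin_charM ?abel_lin ?groupX // Dzi mul1r lin_charX ?abel_lin.
rewrite defw -orderE.
have [|m prim_m dv_m] := prim_order_exists (order_gt0 w) (z := 'chi_l z1).
  by apply/eqP; rewrite kerX.
suff <-: m = #[w]%g by [].
by apply/eqP; rewrite eqn_dvd dv_m -(kerX l) //= prim_expr_order.
Qed.

(** The values of both characters at a generator are primitive roots of unity
    of the same order, hence conjugate. The exponent [k] shows that the
    automorphism [u] preserves the field of values of ['chi_j]. *)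
Lemma cfker_conjugate j l : cfker 'chi_l = cfker 'chi_j ->
  exists (u : {rmorphism algC -> algC}) (k : nat),
    {in Z, forall z, u ('chi_j z) = 'chi_l z /\ u ('chi_j z) = 'chi_j z ^+ k}.
Proof.
move=> kerl; have [z1 [Zz1 genZ prim1]] := cfker_generator j.
have prim_j := prim1 j erefl; have prim_l := prim1 l kerl.
have [k Dk] := prim_rootP prim_j (prim_expr_order prim_l).
have co_k: coprime k #|(Z / cfker 'chi_j)%g|.
  by rewrite -(prim_root_exp_coprime _ prim_j) -Dk.
have [u Du] := Qn_aut_exists co_k; exists u, k => z /genZ[i Di].
rewrite !Di // rmorphXn Du ?(prim_expr_order prim_j) //.
by rewrite -Dk; split; rewrite // Dk -!exprM mulnC.
Qed.

End AbelianCharacters.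

(** * The rational central idempotent of a fully ramified character *)

Section FullyRamified.

Variables (gT : finGroupType) (G : {group gT}) (mu : Iirr 'Z(G)) (i : Iirr G).
Hypothesis chi_mu : 'chi_i =1 chi_of mu.

Local Notation Z := ('Z(G))%G.
Local Notation N := (cfker 'chi_i).

Lemma abelian_center : abelian Z.
Proof. exact: center_abelian. Qed.

Let n : algC := sqrtC #|(G / 'Z(G))%g|%:R.

Lemma sqrt_index_sq : n ^+ 2 = #|(G / 'Z(G))%g|%:R.
Proof. by rewrite /n sqrtCK. Qed.

Lemma chi_center z : z \in 'Z(G) -> 'chi_i z = n * 'chi_mu z.
Proof. by move=> Zz; rewrite chi_mu /chi_of Zz. Qed.

Lemma chi_off_center g : g \notin 'Z(G) -> 'chi_i g = 0.
Proof. by move=> /negPf nZg; rewrite chi_mu /chi_of nZg. Qed.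

Lemma mu_lin : 'chi_mu \is a linear_char.
Proof. exact: (abel_lin abelian_center). Qed.

Lemma chi1_sqrt : 'chi_i 1%g = n.
Proof. by rewrite chi_center // (lin_char1 mu_lin) mulr1. Qed.

Lemma sqrt_index_neq0 : n != 0.
Proof. by rewrite -chi1_sqrt irr1_neq0. Qed.

Lemma card_center_index : (#|(G / 'Z(G))%g| * #|'Z(G)| = #|G|)%N.
Proof.
by rewrite card_quotient ?gFnorm // mulnC Lagrange ?center_sub.
Qed.

Lemma cfker_chi_mu : N = cfker 'chi_mu.
Proof.
apply/setP=> g; rewrite !cfkerEirr !inE chi1_sqrt (lin_char1 mu_lin).
have [Zg | nZg] := boolP (g \in 'Z(G)).
  by rewrite chi_center // -{2}[n]mulr1 (can_eq (mulKf sqrt_index_neq0)).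
rewrite chi_off_center // (cfun0 _ nZg) !(eq_sym 0).
by rewrite (negPf sqrt_index_neq0) oner_eq0.
Qed.

Section Idempotent.

Variables (f : gT -> algC) (l : Iirr 'Z(G)).
Hypothesis f_center : {in 'Z(G), forall z, f z = n * 'chi_l z}.
Hypothesis f_off_center : forall g, g \notin 'Z(G) -> f g = 0.

Lemma pcidem_on_center : pcidem G f \in gralg_on 'Z(G).
Proof.
apply: gralg_onZ; apply: gralg_on_bigsum => g _.
have [Zg | /f_off_center->] := boolP (g \in 'Z(G)); last first.
  by rewrite scale0r gralg_on0.
by rewrite gralg_onZ // gralg_on_base ?groupV.
Qed.

(** Since [n ^+ 2 * #|Z| = #|G|], the scalar factors are exactly those of the
    idempotent of the linear character of the center. *)
Lemma gev_pcidem (j : Iirr 'Z(G)) : gev 'Z(G) 'chi_j (pcidem G f) = (j == l)%:R.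
Proof.
rewrite gevZ raddf_sum /= (big_setID 'Z(G)) /= [X in _ + X]big1 ?addr0; last first.
  by move=> g /setDP[_ /f_off_center->]; rewrite scale0r raddf0.
rewrite (setIidPr (center_sub G)).
rewrite (eq_bigr (fun z => n * ('chi_l z * 'chi_j z^-1%g))); last first.
  by move=> z Zz; rewrite gevZ gev_base ?groupV // f_center // mulrA.
rewrite -mulr_sumr f_center // lin_char1 ?(abel_lin abelian_center) // mulr1.
rewrite mulrA [_ * n]mulrAC -expr2 sqrt_index_sq.
rewrite eq_sym -first_orthogonality_relation -card_center_index natrM invfM.
rewrite mulrA mulfV ?mul1r // pnatr_eq0 -lt0n cardG_gt0 //.
Qed.

End Idempotent.

(** Both sides are compared at the characters of the center. At ['chi_j] the
    left-hand side counts the automorphisms of the field of values that map [mu]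
    to ['chi_j]: there is at most one, since the values generate the field, and
    there is one exactly when ['chi_j] and [mu] have the same kernel. *)
Lemma pcidemQ_epsilon :
  pcidemQ i = gralgQC (epsilon rat 'Z(G)%G [group of N]).
Proof.
rewrite gralgQC_epsilon /pcidemQ.
case: (group_num_field_exists G) => Qn galQn [QnC ext_gal [w gen_w Qn_val]].
set chiQ := fun g => _; set Qchi := <<1 & _>>%AS.
have chiQE g : QnC (chiQ g) = 'chi_i g.
  rewrite /chiQ; case: insubP => [u _ <- | nGg]; first by case: (Qn_val _ _ _).
  by rewrite rmorph0 cfun0.
have Qchi_chiQ g : g \in G -> chiQ g \in Qchi.
  by move=> Gg; apply/seqv_sub_adjoin/image_f.
pose ext (s : gal_of Qchi) := extend_algC_subfield_aut QnC s.
pose lam s := aut_Iirr (sval (ext s)) mu.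
have lamE s g : 'chi_(lam s) g = sval (ext s) ('chi_mu g).
  by rewrite aut_IirrE cfunE.
have extE (s : gal_of Qchi) x : QnC (s x) = sval (ext s) (QnC x).
  by case: (ext s) => /= u ->.
have aut_n (u : {rmorphism algC -> algC}) : u n = n.
  by rewrite -chi1_sqrt irr1_degree rmorph_nat.
have f_center (s : gal_of Qchi) :
    {in 'Z(G), forall z, QnC (s (chiQ z)) = n * 'chi_(lam s) z}.
  by move=> z Zz; rewrite extE chiQE chi_center // rmorphM aut_n lamE.
have f_off_center (s : gal_of Qchi) g : g \notin 'Z(G) -> QnC (s (chiQ g)) = 0.
  by move=> nZg; rewrite extE chiQE chi_off_center ?rmorph0.
have abelZ := abelian_center.
have sNZ : N \subset 'Z(G) by rewrite cfker_chi_mu cfker_sub.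
apply: (gev_irr_ext abelZ).
- by apply: gralg_on_bigsum => s _; apply: (pcidem_on_center (f_off_center s)).
- exact: gralg_on_epsilon.
move=> j; rewrite gev_epsilon // raddf_sum /=.
rewrite (eq_bigr (fun s => (j == lam s)%:R)) => [|s _]; last first.
  by apply: gev_pcidem; [apply: f_center | apply: f_off_center].
have [kerj | kerj] := eqVneq (cfker 'chi_j) N; last first.
  rewrite big1 // => s _; case: eqP => // Dj; case/eqP: kerj; rewrite Dj.
  by rewrite aut_IirrE cfker_aut cfker_chi_mu.
rewrite cfker_chi_mu in kerj.
have [u [k Du]] := cfker_conjugate abelZ kerj.
have [nu0 Dnu0] := restrict_aut_to_normal_num_field QnC u.
(* The automorphism [u] permutes the values [n * mu z] of ['chi_i]. *)
have nu0_chiQ g : g \in G -> nu0 (chiQ g) \in Qchi.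
  move=> Gg; have [Zg | nZg] := boolP (g \in 'Z(G)).
    have [_ Dk] := Du g Zg; suff ->: nu0 (chiQ g) = chiQ (g ^+ k)%g.
      by rewrite Qchi_chiQ ?groupX.
    apply: (fmorph_inj QnC); rewrite Dnu0 !chiQE !chi_center ?groupX //.
    by rewrite rmorphM aut_n Dk lin_charX ?mu_lin.
  have ->: chiQ g = 0.
    by apply: (fmorph_inj QnC); rewrite chiQE rmorph0 chi_off_center.
  by rewrite rmorph0 mem0v.
have kAut_nu0 : kAut 1 Qchi (linfun nu0).
  rewrite kAutE; apply/andP; split.
    apply/kHomP_tmp; split=> [x /vlineP[a ->] | x y _ _]; rewrite !lfunE /=.
      by rewrite linearZ /= rmorph1.
    exact: rmorphM.
  rewrite (aimg_adjoin_seq (linfun_ahom nu0)) aimg1.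
  apply/Fadjoin_seqP; split=> [|_ /mapP[_ /imageP[g Gg ->] ->]]; first exact: sub1v.
  by rewrite /= lfunE nu0_chiQ.
have [s0 Gs0 Ds0] := kAut_to_gal kAut_nu0.
have lam_s0 : j = lam s0.
  apply/irr_inj/cfun_inP=> z Zz; apply: (mulfI sqrt_index_neq0).
  rewrite -f_center // -Ds0 ?Qchi_chiQ ?(subsetP (center_sub G)) //.
  rewrite lfunE /= Dnu0 chiQE chi_center // rmorphM aut_n.
  by have [-> _] := Du z Zz.
rewrite (bigD1 s0) //= -lam_s0 eqxx big1 ?addr0 // => s /andP[_ s_neq].
case: eqP => // lam_s; case/eqP: s_neq.
(* Two automorphisms with the same conjugate of [mu] agree on the values of
   ['chi_i], which generate the field. *)
have eq_chiQ g : g \in G -> s (chiQ g) = s0 (chiQ g).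
  move=> Gg; apply: (fmorph_inj QnC); have [Zg | nZg] := boolP (g \in 'Z(G)).
    by rewrite !f_center // -lam_s -lam_s0.
  by rewrite !f_off_center.
apply/eqP; rewrite eq_mulgV1; apply/gal_eqP=> x Qx.
suff /subvP/(_ x Qx): (Qchi <= fixedField [set (s * s0^-1)%g])%VS.
  by move/(fixedFieldP Qx)=> ->; rewrite ?set11 // gal_id.
apply/Fadjoin_seqP; split=> [|_ /imageP[g Gg ->]]; first exact: sub1v.
apply/fixedFieldP=> [|_ /set1P->]; first exact: Qchi_chiQ.
rewrite galM ?Qchi_chiQ // eq_chiQ // -galM ?Qchi_chiQ //.
by rewrite mulgV gal_id.
Qed.

End FullyRamified.

(** * Matrix units from a decomposition of an idempotent *)

(** The products [u i * v j] are matrix units for [e], so that an element [x]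
    of the corner ring of [e] is determined by its entries [v i * x * u j],
    which are arbitrary elements of the corner ring of [f]. *)
Lemma matrix_units_iso (gT : finGroupType) (G : {group gT}) (B : pzRingType)
    (k : nat) (e f : gralg rat gT) (phi : {additive B -> gralg rat gT})
    (u v : 'I_k -> gralg rat gT) :
    {morph phi : a b / a * b} -> injective phi -> phi 1 = f ->
    (forall a, phi a \in gralg_on G) ->
    (forall i, u i \in gralg_on G) -> (forall i, v i \in gralg_on G) ->
    (forall i j, v i * u j = if i == j then f else 0) ->
    (forall i, u i * f = u i) -> (forall i, f * v i = v i) ->
    \sum_i u i * v i = e ->
    (forall y, y \in gralg_on G -> e * y = y * e) ->
    (forall y i j, y \in gralg_on G -> exists a, phi a = v i * y * u j) ->
  QG_component_iso G e 'M[B]_k.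
Proof.
move=> phiM phi_inj phi1 Gphi Gu Gv vu uf fv def_e cen_e phi_surj.
have eu j : e * u j = u j.
  rewrite -def_e mulr_suml (bigD1 j) //= -mulrA vu eqxx uf big1 ?addr0 // => i.
  by move=> /negPf ij; rewrite -mulrA vu ij mulr0.
have ve j : v j * e = v j.
  rewrite -def_e mulr_sumr (bigD1 j) //= mulrA vu eqxx fv big1 ?addr0 // => i.
  by rewrite eq_sym => /negPf ij; rewrite mulrA vu ij mul0r.
have fphi a : f * phi a = phi a by rewrite -phi1 -phiM mul1r.
have phif a : phi a * f = phi a by rewrite -phi1 -phiM mulr1.
pose F (M : 'M[B]_k) : gralg rat gT := \sum_i \sum_j u i * phi (M i j) * v j.
have F_zmod : zmod_morphism F.
  move=> M M'; rewrite /F -sumrB; apply: eq_bigr => i _; rewrite -sumrB.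
  by apply: eq_bigr => j _; rewrite !mxE raddfB mulrBr mulrBl.
have vFu M i j : v i * F M * u j = phi (M i j).
  rewrite /F mulr_sumr mulr_suml (bigD1 i) //= [X in _ + X]big1 ?addr0.
    rewrite mulr_sumr mulr_suml (bigD1 j) //=.
    rewrite [X in _ + X]big1 ?addr0 => [|j' /negPf j'j].
      by rewrite -!mulrA vu eqxx !mulrA vu eqxx fphi phif.
    by rewrite -!mulrA vu j'j !mulr0.
  move=> i' /negPf i'i; rewrite mulr_sumr mulr_suml big1 // => j' _.
  by rewrite !mulrA vu eq_sym i'i !mul0r.
have ee : e * e = e.
  rewrite -{1}def_e mulr_suml -[RHS]def_e; apply: eq_bigr => i _.
  by rewrite -mulrA ve.
have decomp x : e * x * e = x -> x = \sum_i \sum_j u i * (v i * x * u j) * v j.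
  move=> {1}<-; rewrite -def_e mulr_suml mulr_suml; apply: eq_bigr => i _.
  by rewrite mulr_sumr; apply: eq_bigr => j _; rewrite !mulrA.
pose FA : {additive 'M[B]_k -> gralg rat gT} :=
  HB.pack F (GRing.isZmodMorphism.Build _ _ F F_zmod).
have eF M : e * F M * e = F M.
  rewrite /F mulr_sumr mulr_suml; apply: eq_bigr => i _.
  rewrite mulr_sumr mulr_suml; apply: eq_bigr => j _.
  by rewrite -!mulrA ve !mulrA eu.
have eFl M : e * F M = F M by rewrite -[F M in LHS]eF !mulrA ee eF.
have eFr M : F M * e = F M by rewrite -[F M in LHS]eF -!mulrA ee !mulrA eF.
exists FA; split.
- move=> M M' eqF; apply/matrixP=> i j; apply: phi_inj.
  by rewrite -!vFu -[F M]/(FA M) eqF.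
- move=> M M' /=; rewrite [LHS]decomp // [RHS]decomp; last first.
    by rewrite mulrA eFl -mulrA eFr.
  apply: eq_bigr => i _; apply: eq_bigr => j _; congr (_ * _ * _).
  rewrite vFu mxE raddf_sum -[F M']eFl -def_e mulr_suml !mulr_sumr mulr_suml.
  by apply: eq_bigr => l _; rewrite /= phiM -!vFu !mulrA.
- rewrite -def_e /= /F; apply: eq_bigr => i _.
  rewrite (bigD1 i) //= mxE eqxx phi1 uf big1 ?addr0 // => j /negPf ij.
  by rewrite mxE eq_sym ij raddf0 mulr0 mul0r.
move=> x; split=> [[M <-] | [y Gy ->]].
  exists (F M); last by rewrite /= -[LHS]eFr.
  by do 2!(apply: gralg_on_bigsum => ? _); rewrite !gralg_onM.
have phi_y i j := sig_eqW (phi_surj y i j Gy).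
exists (\matrix_(i, j) sval (phi_y i j)); rewrite [RHS]decomp; last first.
  by rewrite mulrA cen_e // -!mulrA !ee.
apply: eq_bigr => i _; apply: eq_bigr => j _.
rewrite -(mulrA (v i)) -(mulrA y) eu mxE.
by case: (phi_y i j) => a /= ->; rewrite (mulrA (v i)).
Qed.

(** * The commutator pairing of a group of class two *)

Section Pairing.

Variables (gT : finGroupType) (G : {group gT}) (mu : Iirr 'Z(G)).

Local Notation Z := ('Z(G))%G.
Local Notation N := [group of cfker 'chi_mu].

Hypothesis derG : G^`(1)%g \subset 'Z(G).
Hypothesis nondegenerate :
  {in G, forall x, {in G, forall g, [~ x, g]%g \in N} -> x \in 'Z(G)}.

Lemma ker_sub_center : N \subset Z.
Proof. exact: cfker_sub. Qed.

Lemma ker_normal : N <| G.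
Proof. exact: sub_center_normal ker_sub_center. Qed.

Lemma ker_norm : G \subset 'N(N).
Proof. by case/andP: ker_normal. Qed.

Lemma comm_center x g : x \in G -> g \in G -> [~ x, g]%g \in 'Z(G).
Proof. by move=> Gx Gg; rewrite (subsetP derG) // mem_commg. Qed.

Lemma center_commute z g : z \in 'Z(G) -> g \in G -> commute z g.
Proof. by move=> /centerP[_ cz] /cz. Qed.

Lemma pairMl x y g : x \in G -> y \in G -> g \in G ->
  [~ x * y, g]%g = ([~ x, g] * [~ y, g])%g.
Proof.
move=> Gx Gy Gg; rewrite commMgJ; congr (_ * _)%g; apply/conjg_fixP/commgP.
exact: center_commute (comm_center Gx Gg) Gy.
Qed.

Lemma pairMr x g h : x \in G -> g \in G -> h \in G ->
  [~ x, g * h]%g = ([~ x, g] * [~ x, h])%g.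
Proof.
move=> Gx Gg Gh; rewrite commgMJ.
have cxg := comm_center Gx Gg; have cxh := comm_center Gx Gh.
have ->: ([~ x, g] ^ h = [~ x, g])%g.
  by apply/conjg_fixP/commgP; apply: center_commute cxg Gh.
by apply: center_commute => //; rewrite (subsetP (center_sub G)).
Qed.

(** The subgroup orthogonal to [X] for the pairing [mu [~ x, g]]. *)
Definition orthogonal_group (X : {set gT}) :=
  (G :&: coset N @*^-1 'C(X / N))%G.

Lemma orthogonalP (X : {group gT}) g : X \subset G -> g \in G ->
  reflect {in X, forall x, [~ x, g]%g \in N} (g \in orthogonal_group X).
Proof.
move=> sXG Gg; have nNg : g \in 'N(cfker 'chi_mu) := subsetP ker_norm g Gg.
have ->: (g \in orthogonal_group X) = (coset N g \in 'C(X / N)%g).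
  by rewrite inE Gg /= morphpreE in_setI nNg inE.
apply: (iffP centP) => [cg x Xx | cg y].
  have nNx := subsetP ker_norm x (subsetP sXG x Xx).
  apply: coset_idr; first exact: groupR.
  by rewrite morphR //=; apply/eqP/commgP/commute_sym/cg/mem_quotient.
case/morphimP=> x nNx Xx -> /=; apply/commute_sym/commgP.
by rewrite -morphR //= coset_id ?cg.
Qed.

Lemma orthogonal_sub X : orthogonal_group X \subset G.
Proof. exact: subsetIl. Qed.

Lemma center_orthogonal (X : {group gT}) : X \subset G ->
  Z \subset orthogonal_group X.
Proof.
move=> sXG; apply/subsetP=> z Zz; have Gz := subsetP (center_sub G) z Zz.
apply/orthogonalP=> // x Xx; rewrite (_ : [~ x, z]%g = 1%g) ?group1 //.
by apply/eqP/commgP/commute_sym/center_commute/(subsetP sXG).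
Qed.

Let mu_lin : 'chi_mu \is a linear_char.
Proof. exact: (abel_lin (center_abelian G)). Qed.

(** Count the pairs by summing the values of the pairing: by orthogonality, the
    sum over [X] of [mu [~ x, g]] is [#|X|] if [g] is orthogonal to [X] and
    zero otherwise, and the sum over [G] is non-zero only if [x] is central. *)
Lemma card_orthogonal (X : {group gT}) : X \subset G ->
  (#|X| * #|orthogonal_group X| = #|G| * #|X :&: 'Z(G)|)%N.
Proof.
move=> sXG; pose P x g := 'chi_mu [~ x, g]%g.
have memN z : z \in 'Z(G) -> (z \in N) = ('chi_mu z == 1).
  exact: (mem_cfker_lin (center_abelian G)).
have sumX g : g \in G ->
    \sum_(x in X) P x g = if g \in orthogonal_group X then #|X|%:R else 0.
  move=> Gg; rewrite sum_multiplicative => [|x y Xx Xy|]; last 2 first.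
  - have [Gx Gy] := (subsetP sXG x Xx, subsetP sXG y Xy).
    by rewrite /P /= pairMl // lin_charM ?comm_center.
  - by rewrite /P comm1g lin_char1.
  congr (if _ then _ else _); apply/forall_inP/orthogonalP=> // Xg x Xx.
    by rewrite memN; [apply: Xg | apply: comm_center (subsetP sXG x Xx) Gg].
  by rewrite /P -memN; [apply: Xg | apply: comm_center (subsetP sXG x Xx) Gg].
have sumG x : x \in G ->
    \sum_(g in G) P x g = if x \in 'Z(G) then #|G|%:R else 0.
  move=> Gx; rewrite sum_multiplicative => [|g h Gg Gh|]; last 2 first.
  - by rewrite /P /= pairMr // lin_charM ?comm_center.
  - by rewrite /P commg1 lin_char1.
  congr (if _ then _ else _); apply/forall_inP/idP=> [Gx1 | Zx g Gg].
    by apply: nondegenerate => // g Gg; rewrite memN ?comm_center ?Gx1.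
  rewrite /P (_ : [~ x, g]%g = 1%g) ?lin_char1 //.
  exact/eqP/commgP/center_commute.
have: \sum_(g in G) \sum_(x in X) P x g = \sum_(x in X) \sum_(g in G) P x g.
  exact: exchange_big.
rewrite (eq_bigr _ sumX) -big_mkcondr /=.
rewrite (eq_bigl (mem (orthogonal_group X))) => [|g]; last first.
  by rewrite /= andb_idl //; apply: (subsetP (orthogonal_sub X)).
rewrite [RHS](eq_bigr (fun x => if x \in 'Z(G) then #|G|%:R else 0)); last first.
  by move=> x Xx; rewrite sumG ?(subsetP sXG).
rewrite -[RHS]big_mkcondr /= [RHS](eq_bigl (mem (X :&: 'Z(G)))); last first.
  by move=> x; apply/esym/in_setI.
by rewrite !sumr_const -!mulrnA => /eqP; rewrite eqr_nat => /eqP.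
Qed.

End Pairing.

(** * Maximal isotropic subgroups *)

(** The only generalized quaternion group of class two is the one of order
    eight, since its derived subgroup lies in a center of order two. *)
Lemma quaternion_class_two (hT : finGroupType) (W A : {group hT}) :
    extremal_class W = Quaternion -> A \subset 'Z(W) -> W^`(1)%g \subset A ->
  exists x y, [/\ #|A| = 2%N, #|W| = 8%N, x \in W /\ y \in W,
    [/\ (x ^+ 2)%g \in A^#%g, (y ^+ 2)%g \in A^#%g & [~ x, y]%g \in A^#%g]
  & {in W, forall w, exists a b : bool, exists2 t,
        t \in A & w = (x ^+ a * y ^+ b * t)%g}].
Proof.
case/quaternion_classP=> m m_gt2 isoW sAZ sW'A.
have [[x y] genW [oy y2 xy]] := generators_quaternion m_gt2 isoW.
have [oW Wx ox /setDP[Wy _]] := genW.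
have [_ [_ _ oW' _] [_ oZ _ _ _] _ _] := quaternion_structure m_gt2 genW isoW.
have [_ _ _ defW _] := extremal_generators_facts (isT : prime 2) genW.
(* The derived subgroup has order [2 ^ m.-2], the center order two. *)
have m3 : m = 3%N.
  apply/eqP; rewrite eqn_leq m_gt2 andbT.
  have: (#|W^`(1)%g| <= #|'Z(W)%g|)%N.
    by rewrite subset_leq_card ?(subset_trans sW'A).
  rewrite oW' oZ -[X in (_ <= X)%N]expn1 leq_exp2l //.
  by case: (m) m_gt2 => [|[|[|[|]]]].
rewrite {}m3 /= in oW ox oW' y2 *.
have oA : #|A| = 2%N.
  apply/eqP; rewrite eqn_leq -{1}oZ subset_leq_card //=.
  by rewrite -[X in (X <= _)%N]oW' subset_leq_card.
have defA : A = 'Z(W)%g :> {set hT}.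
  by apply/eqP; rewrite eqEcard sAZ oA oZ.
have x2_neq1 : (x ^+ 2)%g != 1%g by rewrite -order_dvdn ox.
have Dcxy : [~ x, y]%g = (x ^- 2)%g.
  by rewrite commgEl xy -invMg.
have Acxy : [~ x, y]%g \in A by rewrite (subsetP sW'A) ?mem_commg.
have Ax2 : (x ^+ 2)%g \in A by rewrite -groupV -Dcxy.
have Ay2 : (y ^+ 2)%g \in A by rewrite y2.
exists x, y; split=> //.
  by rewrite !inE Ay2 Ax2 Acxy y2 x2_neq1 Dcxy invg_eq1 x2_neq1.
move=> w; rewrite -defW => /mulsgP[_ _ /cycleP[i ->] /cycleP[j ->] ->].
exists (odd i), (odd j); exists ((x ^+ 2) ^+ i./2 * (y ^+ 2) ^+ j./2)%g.
  by apply: groupM; apply: groupX.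
have cA t w' : t \in A -> w' \in W -> commute t w'.
  by move=> At Ww'; have /centerP[_ ct] := subsetP sAZ t At; apply: ct.
rewrite -{1}(odd_double_half i) -{1}(odd_double_half j) -!muln2 !expgD.
rewrite ![(_ * 2)%N]mulnC !expgM -!mulgA; congr (_ * _)%g.
rewrite !mulgA; congr (_ * _)%g.
by apply: cA; rewrite groupX.
Qed.

Section MaximalIsotropic.

Variables (gT : finGroupType) (G : {group gT}) (mu : Iirr 'Z(G)).

Local Notation Z := ('Z(G))%G.
Local Notation N := [group of cfker 'chi_mu].

Hypothesis derG : G^`(1)%g \subset 'Z(G).
Hypothesis nondegenerate :
  {in G, forall x, {in G, forall g, [~ x, g]%g \in N} -> x \in 'Z(G)}.

(** Such a [Y] corresponds to a subgroup of [G / Z] that is totally isotropic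
    for the pairing, together with an extension of [mu] to its preimage in [G]
    that is trivial on [Y]. *)
Definition isotropic (Y : {group gT}) :=
  [&& N \subset Y, Y \subset G & Y :&: 'Z(G) \subset N].

Lemma maximal_isotropic_exists :
  exists Y : {group gT}, maxgroup Y isotropic.
Proof.
have [|Y maxY] := @ex_maxgroup _ isotropic; last by exists Y.
exists N; rewrite /isotropic subxx subsetIl.
by rewrite (subset_trans (ker_sub_center mu)) ?center_sub.
Qed.

Variable Y : {group gT}.
Hypothesis isoY : isotropic Y.

Local Notation C := (orthogonal_group mu Y).

Let sNY : N \subset Y. Proof. by case/and3P: isoY. Qed.
Let sYG : Y \subset G. Proof. by case/and3P: isoY. Qed.
Let sYZN : Y :&: 'Z(G) \subset N. Proof. by case/and3P: isoY. Qed.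
Let sCG : C \subset G. Proof. exact: orthogonal_sub. Qed.
Let sZC : Z \subset C. Proof. exact: center_orthogonal. Qed.

Lemma isotropic_capZ : Y :&: 'Z(G) = N.
Proof. by apply/eqP; rewrite eqEsubset sYZN subsetI sNY ker_sub_center. Qed.

Lemma isotropic_not_orthogonal y : y \in Y -> y \notin N ->
  exists2 h, h \in G & [~ y, h]%g \notin N.
Proof.
move=> Yy nNy; have nZy : y \notin 'Z(G).
  by apply: contra nNy => Zy; rewrite (subsetP sYZN) // in_setI Yy.
have : ~~ [forall h in G, [~ y, h]%g \in N].
  apply: contra nZy => /forall_inP; apply: nondegenerate.
  exact: (subsetP sYG).
by rewrite negb_forall_in => /exists_inP.
Qed.

Lemma isotropic_sub_orthogonal : Y \subset C.
Proof.
apply/subsetP=> y Yy; have Gy := subsetP sYG y Yy.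
apply/orthogonalP=> // x Yx; apply: (subsetP sYZN).
by rewrite inE groupR // comm_center // (subsetP sYG).
Qed.
Let sYC := isotropic_sub_orthogonal.

Lemma orthogonal_norm : C \subset 'N(Y).
Proof.
apply/subsetP=> c Cc; have Gc := subsetP sCG c Cc; rewrite inE.
apply/subsetP=> _ /imsetP[y Yy ->]; rewrite -[(y ^ c)%g](mulKVg y) -commgEl.
rewrite groupM // (subsetP sNY) //.
by have /orthogonalP-> := Cc.
Qed.
Let nYC := orthogonal_norm.

Let nsYC : Y <| C. Proof. by rewrite /normal sYC. Qed.
Let nYZ : Z \subset 'N(Y). Proof. exact: subset_trans sZC nYC. Qed.

Lemma card_isotropic : (#|Y| * #|C| = #|G| * #|N|)%N.
Proof. by rewrite card_orthogonal // isotropic_capZ. Qed.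

Lemma card_isotropic_center : (#|Y * 'Z(G)|%g * #|N| = #|Y| * #|'Z(G)|)%N.
Proof. by rewrite -isotropic_capZ mul_cardG. Qed.

(** One inclusion is clear, and both sides have the same order by
    [card_orthogonal], applied to [Y] and to [C]. *)
Lemma double_orthogonal : orthogonal_group mu C = (Y * 'Z(G))%g :> {set gT}.
Proof.
apply/esym/eqP; rewrite eqEcard; apply/andP; split.
  rewrite mul_subG ?center_orthogonal //; apply/subsetP=> y Yy.
  apply/orthogonalP=> // [|c Cc]; first exact: (subsetP sYG).
  rewrite -groupV invg_comm; have Gc := subsetP sCG c Cc.
  by have /orthogonalP-> := Cc.
rewrite -(leq_pmul2l (cardG_gt0 C)) card_orthogonal //.
rewrite (setIidPr sZC) -(leq_pmul2r (cardG_gt0 N)) -!mulnA card_isotropic_center.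
rewrite [X in (_ <= X)%N]mulnCA [X in (_ <= X)%N]mulnA card_isotropic.
by rewrite -mulnA [(#|N| * _)%N]mulnC.
Qed.

(** The commutators of [C] are central and, as [C / Y] is abelian, they lie in
    [Y]; hence they lie in [N], and [C] is contained in its own orthogonal. *)
Lemma orthogonal_cyclic : cyclic (C / Y)%g -> C = (Y * 'Z(G))%g :> {set gT}.
Proof.
move=> cycW; have abelW := cyclic_abelian cycW.
have derC : C^`(1)%g \subset Y by rewrite -quotient_cents2 // in abelW *.
apply/eqP; rewrite eqEsubset mul_subG // andbT -double_orthogonal.
apply/subsetP=> c Cc; have Gc := subsetP sCG c Cc.
apply/orthogonalP=> // c' Cc'; apply: (subsetP sYZN).
by rewrite inE (subsetP derC) ?mem_commg // comm_center // (subsetP sCG).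
Qed.

Section MaximalPGroup.

Variable p : nat.
Hypotheses (pG : p.-group G) (nZN : ~~ (Z \subset N)) (maxY : maxgroup Y isotropic).

Let ZbarE : (Z / Y)%g \isog (Z / N)%g.
Proof.
rewrite isog_sym; have := second_isog nYZ.
by rewrite /= isotropic_capZ.
Qed.

(** By maximality, a subgroup of order [p] of [C / Y] meets the image of the
    center; the latter being cyclic, [C / Y] has only one such subgroup. *)
Lemma maximal_isotropic_quotient :
  cyclic (C / Y)%g \/ p = 2%N /\ extremal_class (C / Y)%g = Quaternion.
Proof.
have pW : p.-group (C / Y)%g by rewrite quotient_pgroup ?(pgroupS sCG).
have sZW : (Z / Y \subset C / Y)%g by rewrite quotientS.
have ntZ : (Z / Y)%g != 1%g.
  rewrite -subG1 quotient_sub1 //; apply: contra nZN => sZY.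
  by rewrite (subset_trans _ sYZN) // subsetI sZY subxx.
have ntW : (C / Y)%g != 1%g by apply: contra ntZ => /eqP trW; rewrite -subG1 -trW.
have cycZ : cyclic (Z / Y)%g.
  rewrite (isog_cyclic ZbarE) /=.
  have:= cfcenter_cyclic 'chi_mu; congr (cyclic (_ / _)%g).
  apply/eqP; rewrite eqEsubset cfcenter_sub; apply/subsetP=> z Zz.
  have linmu := abel_lin (center_abelian G) mu.
  by rewrite irr_cfcenterE // normC_lin_char ?lin_char1.
have sOhmZ : ('Ohm_1(C / Y) \subset Z / Y)%g.
  rewrite Ohm1Eprime gen_subG; apply/subsetP=> x /setIdP[Wx pr_x].
  apply: contraLR pr_x => nZx; apply/negP=> pr_x.
  pose X := (coset Y @*^-1 <[x]>)%G.
  have sXC : X \subset C.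
    by rewrite -(quotientGK nsYC) morphpreS ?cycle_subG.
  have TIx : <[x]>%g :&: (Z / Y)%g = 1%g.
    by apply: prime_TIg; rewrite // cycle_subG.
  (* A subgroup of prime order that avoids the image of the center has an
     isotropic preimage, which is larger than [Y]. *)
  have isoX : isotropic X.
    have sYX : Y \subset X by exact: sub_cosetpre.
    apply/and3P; split; first exact: subset_trans sYX.
      exact: subset_trans sXC sCG.
    apply/subsetP=> z /setIP[Xz Zz]; apply: (subsetP sYZN); rewrite inE Zz andbT.
    apply: coset_idr; first exact: (subsetP nYZ).
    apply/set1P; rewrite -[[set 1%g]]TIx inE mem_quotient // andbT.
    by move: Xz; rewrite inE => /andP[_]; rewrite inE.
  have [_ /(_ X isoX (sub_cosetpre _)) defX] := maxgroupP maxY.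
  have: (<[x]> = 1)%g.
    by rewrite -(cosetpreK <[x]>%G) -[(_ @*^-1 _)%g]/(gval X) defX trivg_quotient.
  by move/eqP; rewrite cycle_eq1 => /eqP x1; rewrite x1 order1 in pr_x.
have oOhm : #|'Ohm_1(C / Y)%g| = p.
  have pZ := pgroupS sZW pW.
  rewrite -(Ohm1_cyclic_pgroup_prime cycZ pZ ntZ).
  have sOhm : ('Ohm_1(C / Y) \subset 'Ohm_1(Z / Y))%g.
    by have := OhmS 1 sOhmZ; rewrite Ohm_id.
  by apply/eqP; rewrite eqn_leq !subset_leq_card // OhmS.
move/(prime_Ohm1P pW ntW): oOhm => /orP[|/andP[/eqP-> /eqP]]; by [left | right].
Qed.

Lemma orthogonal_quaternion : extremal_class (C / Y)%g = Quaternion ->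
  exists x y, [/\ x \in C /\ y \in C, #|(Z / N)%g| = 2%N,
    (#|C| = 8 * #|Y|)%N,
    [/\ exists2 z, z \in 'Z(G) :\: N & (x ^+ 2 * z^-1)%g \in Y,
        exists2 z, z \in 'Z(G) :\: N & (y ^+ 2 * z^-1)%g \in Y
      & [~ x, y]%g \in 'Z(G) :\: N]
  & {in C, forall c, exists (a b : bool), exists2 t,
      t \in (Y * 'Z(G))%g & c = (x ^+ a * y ^+ b * t)%g}].
Proof.
move=> quatW.
have cZ : (Z / Y \subset 'Z(C / Y))%g.
  rewrite subsetI quotientS //= quotient_cents //.
  exact: subset_trans (subsetIr _ _) (centS sCG).
have dW : ((C / Y)^`(1) \subset Z / Y)%g.
  rewrite -quotient_der // quotientS //; exact: subset_trans (dergS 1 sCG) derG.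
have [u [v [oZ oW [Wu Wv] [u2 v2 uv] decW]]] := quaternion_class_two quatW cZ dW.
have [x nYx Cx Du] := morphimP Wu; have [y nYy Cy Dv] := morphimP Wv.
rewrite {}Du {}Dv {Wu Wv} in u2 v2 uv decW.
have nNZY z : z \in 'Z(G) -> z \in 'N(Y) by apply: (subsetP nYZ).
have lift g : g \in 'N(Y) -> coset Y g \in (Z / Y)^#%g ->
    exists2 z, z \in 'Z(G) :\: N & (g * z^-1)%g \in Y.
  move=> nYg /setD1P[g_neq1 /morphimP[z nYz Zz Dg]]; exists z.
    rewrite inE Zz andbT; apply: contra g_neq1 => Nz.
    by rewrite Dg /= coset_id // (subsetP sNY).
  apply: coset_idr; first by rewrite groupM ?groupV.
  by rewrite morphM ?groupV // morphV //= Dg mulgV.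
exists x, y; split=> //.
- by rewrite -(card_isog ZbarE).
- by rewrite -oW card_quotient // mulnC Lagrange.
- split; try by apply: lift; rewrite ?groupX // morphX.
  have [z /setDP[Zz nNz] Yz] : exists2 z,
      z \in 'Z(G) :\: N & ([~ x, y] * z^-1)%g \in Y.
    by apply: lift; rewrite ?groupR // morphR.
  rewrite inE comm_center ?(subsetP sCG) // andbT; apply: contra nNz => Nxy.
  apply: (subsetP sYZN); rewrite inE Zz andbT -groupV.
  by rewrite -(groupMl _ (subsetP sNY _ Nxy)).
move=> c Cc; have [a [b [t Zt Dc]]] := decW _ (mem_quotient Y Cc).
exists a, b; exists ((x ^+ a * y ^+ b)^-1 * c)%g; last by rewrite mulKVg.
have [z nYz Zz Dt] := morphimP Zt.
have nYc := subsetP nYC c Cc.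
have nYg : (x ^+ a * y ^+ b)%g \in 'N(Y) by rewrite groupM ?groupX.
have Yt : (z^-1 * ((x ^+ a * y ^+ b)^-1 * c))%g \in Y.
  have nYgc : ((x ^+ a * y ^+ b)^-1 * c)%g \in 'N(Y) by rewrite groupM ?groupV.
  apply: coset_idr; first by rewrite groupM ?groupV.
  rewrite morphM ?groupV //= morphV //= morphM ?groupV //= morphV //=.
  by rewrite Dc morphM ?groupX //= !morphX // Dt mulKg mulVg.
rewrite -[X in X \in _](mulKVg z).
set y' := (z^-1 * _)%g in Yt *.
by rewrite (center_commute Zz (subsetP sYG _ Yt)) mem_mulg.
Qed.

End MaximalPGroup.

End MaximalIsotropic.

(** * The idempotent of an isotropic subgroup *)

Section CentralIdempotent.

Variables (gT : finGroupType) (Z N : {group gT}).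
Hypotheses (abelZ : abelian Z) (sNZ : N \subset Z).
Implicit Types x : gralg rat gT.

Local Notation e := (epsilon rat Z N).

Lemma epsilon_on : e \in gralg_on Z.
Proof.
apply/gralg_onP=> g nZg; have := gralg_on_epsilon sNZ.
rewrite -gralgQC_epsilon => /gralg_onP/(_ g nZg); rewrite ffunE.
by move/eqP; rewrite fmorph_eq0 => /eqP.
Qed.

Lemma gralg_center_ext x y : x \in gralg_on Z -> y \in gralg_on Z ->
    (forall j : Iirr Z,
      gev Z 'chi_j (gralgQC x) = gev Z 'chi_j (gralgQC y)) ->
  x = y.
Proof.
move=> Zx Zy eqxy; apply: gralgQC_inj.
by apply: (gev_irr_ext abelZ) => //; apply: gralgQC_on.
Qed.

Lemma gev_epsilonQ (j : Iirr Z) : gev Z 'chi_j (gralgQC e) = (cfker 'chi_j == N)%:R.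
Proof. by rewrite gralgQC_epsilon gev_epsilon. Qed.

Lemma gev_epsilonM (j : Iirr Z) x : x \in gralg_on Z ->
  gev Z 'chi_j (gralgQC (x * e)) =
    gev Z 'chi_j (gralgQC x) * (cfker 'chi_j == N)%:R.
Proof.
move=> Zx; rewrite rmorphM /= gev_irrM ?gralgQC_on ?epsilon_on //.
by rewrite gev_epsilonQ.
Qed.

Lemma epsilon_idem : e * e = e.
Proof.
have Ze := epsilon_on; apply: gralg_center_ext; rewrite ?gralg_onM // => j.
by rewrite gev_epsilonM // gev_epsilonQ -natrM mulnb andbb.
Qed.

Lemma gbase_epsilon z : z \in N -> gbase rat z * e = e.
Proof.
move=> Nz; have Zz := subsetP sNZ z Nz; have Ze := epsilon_on.
have Zbz : gbase rat z \in gralg_on Z by apply: gralg_on_base.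
apply: gralg_center_ext; rewrite ?gralg_onM // => j.
rewrite gev_epsilonM // gev_epsilonQ gralgQC_base gev_base //.
case: eqP => [kerj | _]; last by rewrite mulr0.
by move: Nz; rewrite -kerj mem_cfker_lin // => /eqP->; rewrite mul1r.
Qed.

(** The average over the subgroup generated by [z] vanishes at every character
    with kernel [N], so that it is killed by [e]; but it fixes [x]. *)
Lemma epsilon_fixed0 z x : z \in Z :\: N -> gbase rat z * x = x -> e * x = 0.
Proof.
case/setDP=> Zz nNz zx; have Ze := epsilon_on.
have szZ : <[z]>%G \subset Z by rewrite cycle_subG.
have Zhz : hat rat <[z]> \in gralg_on Z := gralg_onS szZ (gralg_on_hat _ _).
have hz0 : e * hat rat <[z]> = 0.
  apply: gralg_center_ext; rewrite ?gralg_onM ?gralg_on0 // => j.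
  rewrite rmorphM /= gev_irrM ?gralgQC_on // gev_epsilonQ.
  rewrite gralgQC_hat gev_hat // !raddf0.
  case: eqP => [-> | _]; last by rewrite mul0r.
  by rewrite cycle_subG (negPf nNz) mulr0.
rewrite -(@hat_fix _ _ <[z]>%G x) ?mulrA ?hz0 ?mul0r //.
  by rewrite pnatr_eq0 -lt0n cardG_gt0.
move=> _ /cycleP[k ->]; elim: k => [|k IHk]; first by rewrite gbase1 mul1r.
by rewrite expgS gbaseM -mulrA IHk.
Qed.

End CentralIdempotent.

Section IsotropicIdempotent.

Variables (gT : finGroupType) (G : {group gT}) (mu : Iirr 'Z(G)).

Local Notation Z := ('Z(G))%G.
Local Notation N := [group of cfker 'chi_mu].
Local Notation e := (epsilon rat Z N).

Hypothesis derG : G^`(1)%g \subset 'Z(G).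
Hypothesis nondegenerate :
  {in G, forall x, {in G, forall g, [~ x, g]%g \in N} -> x \in 'Z(G)}.

Let abelZ : abelian Z := center_abelian G.
Let sNZ := ker_sub_center mu.
Let sZG : Z \subset G := center_sub G.
Let Ze : e \in gralg_on Z := epsilon_on sNZ.
Let Ge : e \in gralg_on G := gralg_onS sZG Ze.

Lemma epsilon_gbase_commute g : g \in G -> gbase rat g * e = e * gbase rat g.
Proof.
move=> Gg; apply: gbase_commute_on Ze => z Zz.
exact: center_commute Zz Gg.
Qed.

Lemma epsilon_central x : x \in gralg_on G -> e * x = x * e.
Proof. by move=> Gx; rewrite (gralg_on_commute epsilon_gbase_commute Gx). Qed.

Variable Y : {group gT}.
Hypothesis isoY : isotropic mu Y.

Local Notation C := (orthogonal_group mu Y).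

Let sNY : N \subset Y. Proof. by case/and3P: isoY. Qed.
Let sYG : Y \subset G. Proof. by case/and3P: isoY. Qed.
Let sCG : C \subset G. Proof. exact: orthogonal_sub. Qed.
Let GhY : hat rat Y \in gralg_on G := gralg_onS sYG (gralg_on_hat _ _).

(** Locked, so that associativity does not rewrite inside the product. *)
Definition isotropic_idem : gralg rat gT := locked (hat rat Y * e).
Local Notation f := isotropic_idem.

Lemma isotropic_idemE : f = hat rat Y * e.
Proof. by rewrite /f -lock. Qed.

Lemma isotropic_idem_on : f \in gralg_on G.
Proof. rewrite isotropic_idemE; exact: gralg_onM. Qed.

Lemma mul_epsilon_idem : e * f = f.
Proof. by rewrite isotropic_idemE mulrA epsilon_central // -mulrA epsilon_idem. Qed.

Lemma gbase_isotropic y : y \in Y -> gbase rat y * f = f.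
Proof. by move=> Yy; rewrite isotropic_idemE mulrA gbase_hat. Qed.

Lemma isotropic_gbase y : y \in Y -> f * gbase rat y = f.
Proof.
move=> Yy; rewrite isotropic_idemE -mulrA -epsilon_gbase_commute ?(subsetP sYG) //.
by rewrite mulrA hat_gbase.
Qed.

Lemma isotropic_idemK : f * f = f.
Proof.
rewrite {1}isotropic_idemE -mulrA mul_epsilon_idem.
apply: hat_fix gbase_isotropic; by rewrite pnatr_eq0 -lt0n cardG_gt0.
Qed.

Lemma isotropic_commute c : c \in C -> gbase rat c * f = f * gbase rat c.
Proof.
move=> Cc; have Gc := subsetP sCG c Cc; have nYC := orthogonal_norm isoY.
rewrite isotropic_idemE -mulrA -epsilon_gbase_commute // !mulrA; congr (_ * _).
rewrite -gscalerAr -gscalerAl mulr_sumr mulr_suml; congr (_ *: _).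
rewrite [RHS](reindex_inj (conjg_inj c^-1%g)) /=; apply: eq_big => [y | y _].
  by rewrite memJ_norm // groupV (subsetP nYC).
by rewrite -!gbaseM conjgE invgK !mulgA mulgKV.
Qed.

(** Some [y] in [Y] has a commutator [z] with [g] outside [N]. Both [y] and
    [z g y = y g] can be absorbed by [f], so that the product is fixed by [z]. *)
Lemma isotropic_sandwich0 g : g \in G :\: C -> f * gbase rat g * f = 0.
Proof.
case/setDP=> Gg nCg.
have [y Yy nNz] : exists2 y, y \in Y & [~ y, g]%g \notin N.
  have : ~~ [forall y in Y, [~ y, g]%g \in N].
    apply: contra nCg => /forall_inP Ng; exact/orthogonalP.
  by rewrite negb_forall_in => /exists_inP.
have Gy := subsetP sYG y Yy; have Zz := comm_center derG Gy Gg.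
set z := [~ y, g]%g in nNz Zz *; have Gz := subsetP sZG z Zz.
set x := f * _ * f.
have ex : e * x = x by rewrite /x !mulrA mul_epsilon_idem.
rewrite -ex; apply: (epsilon_fixed0 abelZ sNZ (z := z)).
  by rewrite in_setD nNz.
have Gbg : gbase rat g \in gralg_on G by apply: gralg_on_base.
have cz w : w \in gralg_on G -> gbase rat z * w = w * gbase rat z.
  move=> Gw; apply: gbase_commute_on Gw => h Gh.
  exact/commute_sym/(center_commute Zz).
have Gf := isotropic_idem_on.
rewrite /x !mulrA (cz f) // -(mulrA f) -gbaseM.
rewrite -[X in _ * X = _](gbase_isotropic Yy) mulrA -(mulrA f) -gbaseM.
have ->: (z * g * y = y * g)%g.
  by rewrite -mulgA (center_commute Zz (groupM Gg Gy)) /z -commgC.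
by rewrite gbaseM (mulrA f) (isotropic_gbase Yy).
Qed.

Lemma isotropic_sandwich x : x \in gralg_on G ->
  f * x * f = \sum_(c in C) x c *: (gbase rat c * f).
Proof.
move=> Gx; rewrite [in LHS](gralg_on_sum Gx) mulr_sumr mulr_suml (big_setID C) /=.
rewrite [X in _ + X]big1 ?addr0 => [|g GCg].
  rewrite (setIidPr sCG); apply: eq_bigr => g Cg.
  by rewrite -gscalerAr -!gscalerAl -isotropic_commute // -mulrA isotropic_idemK.
by rewrite -gscalerAr -gscalerAl isotropic_sandwich0 // scaler0.
Qed.

(** The conjugates of an element [y] outside [N] include [z y] for some central
    [z] outside [N], so that their sum is killed by [e]. *)
Lemma sum_conj_gbase y : y \in Y ->
  e * \sum_(g in G) gbase rat (g * y * g^-1)%g =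
    if y \in N then #|G|%:R *: e else 0.
Proof.
move=> Yy; have Gy := subsetP sYG y Yy; case: ifPn => [Ny | nNy].
  rewrite mulr_sumr (eq_bigr (fun=> e)) => [|g Gg].
    by rewrite sumr_const scaler_nat.
  have Nyg : (g * y * g^-1)%g \in N.
    have := memJ_norm y (subsetP (ker_norm mu) _ (groupVr Gg)).
    by rewrite Ny conjgE invgK mulgA => ->.
  rewrite -epsilon_gbase_commute ?(gbase_epsilon abelZ sNZ) //.
  by rewrite (subsetP sZG) ?(subsetP sNZ).
have [h Gh nNz] : exists2 h, h \in G & [~ h^-1, y^-1]%g \notin N.
  have [||h Gh nNz] := isotropic_not_orthogonal nondegenerate isoY (y := y^-1%g).
  - by rewrite groupV.
  - by rewrite groupV.
  by exists h^-1%g; rewrite ?groupV // invgK -groupV invg_comm.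
set z := [~ _, _]%g in nNz; have Zz : z \in 'Z(G) by rewrite comm_center ?groupV.
apply: (epsilon_fixed0 abelZ sNZ (z := z)); first by rewrite in_setD nNz.
rewrite mulr_sumr [RHS](reindex_inj (mulIg h)) /=.
apply: eq_big => [g | g Gg]; first by rewrite groupMr.
rewrite -gbaseM; congr gbase.
have -> : (g * h * y * (g * h)^-1 = g * (z * y) * g^-1)%g.
  by rewrite /z commgEl conjgE !invgK invMg !mulgA mulgKV.
by rewrite (mulgA g) -(center_commute Zz Gg) !mulgA.
Qed.

(** The order of [C] comes from the duality [#|Y| * #|C| = #|G| * #|N|]. *)
Lemma sum_conj_isotropic_idem :
  \sum_(g in G) gbase rat g * f * gbase rat g^-1%g = #|C|%:R *: e.
Proof.
transitivity (e * ((#|Y|%:R^-1 : rat) *: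
    \sum_(y in Y) \sum_(g in G) gbase rat (g * y * g^-1)%g)).
  rewrite exchange_big /= scaler_sumr mulr_sumr; apply: eq_bigr => g Gg.
  rewrite isotropic_idemE -epsilon_central // !mulrA epsilon_gbase_commute //.
  rewrite -!mulrA; congr (_ * _); rewrite -gscalerAl -gscalerAr; congr (_ *: _).
  rewrite mulr_suml mulr_sumr; apply: eq_bigr => y Yy.
  by rewrite -!gbaseM mulgA.
rewrite -gscalerAr mulr_sumr (eq_bigr _ sum_conj_gbase) -big_mkcondr /=.
rewrite (eq_bigl (mem N)) => [|y]; last first.
  by rewrite /= andb_idl //; apply: (subsetP sNY).
rewrite sumr_const -scaler_nat !scalerA; congr (_ *: _).
have nzY : #|Y|%:R != 0 :> rat by rewrite pnatr_eq0 -lt0n cardG_gt0.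
apply: (mulfI nzY); rewrite !mulrA mulfV // mul1r -!natrM; congr (_%:R).
by rewrite mulnC -(card_isotropic derG nondegenerate isoY).
Qed.

(** The idempotent [f] has [#|G : C|] distinct orthogonal conjugates, with sum
    [e], and its corner ring is [QC f]. *)
Lemma isotropic_component_iso (B : pzRingType)
    (phi : {additive B -> gralg rat gT}) :
    {morph phi : a b / a * b} -> injective phi -> phi 1 = f ->
    (forall a, phi a \in gralg_on G) ->
    (forall c q, c \in C -> exists a, phi a = q *: (gbase rat c * f)) ->
  QG_component_iso G e 'M[B]_(#|G : C|%g).
Proof.
move=> phiM phi_inj phi1 Gphi phi_surj.
rewrite -card_lcosets; set k := #|_|.
pose t (i : 'I_k) := repr (enum_val i : {set gT}).
have Gt_lcoset i : t i \in G /\ enum_val i = (t i *: C)%g.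
  have [g Gg Di] := lcosetsP (enum_valP i).
  have H: t i \in (g *: C)%g by rewrite /t Di (mem_repr g) ?lcoset_refl.
  split; last by rewrite Di; apply/lcoset_eqP; rewrite lcoset_sym.
  by case/lcosetP: H => c Cc ->; rewrite groupM // (subsetP sCG).
have Gt i := (Gt_lcoset i).1; have lcoset_t i := (Gt_lcoset i).2.
have Gf := isotropic_idem_on.
have Gb g : g \in G -> gbase rat g \in gralg_on G by apply: gralg_on_base.
apply: (matrix_units_iso (u := fun i => gbase rat (t i) * f)
          (v := fun i => f * gbase rat (t i)^-1%g) phiM phi_inj phi1) => //.
- by move=> i; rewrite gralg_onM ?Gb.
- by move=> i; rewrite gralg_onM ?Gb ?groupV.
- move=> i j; rewrite !mulrA -[f * _ * _]mulrA -gbaseM.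
  case: eqP => [-> | /eqP ij]; first by rewrite mulVg gbase1 mulr1 isotropic_idemK.
  apply: isotropic_sandwich0; rewrite in_setD (groupM (groupVr (Gt i)) (Gt j)) andbT.
  apply: contra ij => Cij; apply/eqP/enum_val_inj; rewrite !lcoset_t.
  by apply/lcoset_eqP; rewrite mem_lcoset -groupV invMg invgK.
- by move=> i; rewrite -mulrA isotropic_idemK.
- by move=> i; rewrite mulrA isotropic_idemK.
- apply: (@scalerI _ _ (#|C|%:R : rat)); first by rewrite pnatr_eq0 -lt0n cardG_gt0.
  rewrite -sum_conj_isotropic_idem scaler_sumr.
  rewrite (partition_big (fun g => g *: C)%g (mem (lcosets C G))); last first.
    by move=> g Gg; apply/lcosetsP; exists g.
  rewrite [RHS]big_enum_val -/k. apply: eq_bigr => i _; rewrite lcoset_t.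
  rewrite (eq_bigl (mem (t i *: C)%g)) => [|g]; last first.
    rewrite /= (sameP eqP lcoset_eqP) andb_idl // => /lcosetP[c Cc ->].
    by rewrite groupM // (subsetP sCG).
  rewrite (eq_bigr (fun=> gbase rat (t i) * f * gbase rat (t i)^-1%g)) => [|g].
    rewrite sumr_const card_lcoset scaler_nat !mulrA -(mulrA _ f f).
    by rewrite isotropic_idemK.
  case/lcosetP=> c Cc ->; rewrite invMg !gbaseM -(mulrA _ _ f).
  rewrite (isotropic_commute Cc).
  by rewrite !mulrA -(mulrA _ (gbase rat c)) -gbaseM mulgV gbase1 mulr1.
- exact: epsilon_central.
move=> y i j Gy.
set x := gbase rat (t i)^-1%g * y * gbase rat (t j).
have Gx : x \in gralg_on G by rewrite !gralg_onM ?Gb ?groupV.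
have [a Da] : exists a, phi a = f * x * f.
  rewrite isotropic_sandwich //; elim/big_rec: _ => [|c w Cc [a <-]].
    by exists 0; rewrite raddf0.
  have [a' Da'] := phi_surj c (x c) Cc.
  by exists (a' + a); rewrite raddfD Da'.
by exists a; rewrite Da /x !mulrA.
Qed.

End IsotropicIdempotent.

(** * The rational quaternions *)

(** The norm form is anisotropic over the rationals. *)
Lemma quat_inverse (q : quatQ) : q != 0 -> exists r, r * q = 1 /\ q * r = 1.
Proof.
case: q => [[[a b] c] d] nz_q; pose n := a ^+ 2 + b ^+ 2 + c ^+ 2 + d ^+ 2.
have nz_n : n != 0.
  apply: contraNneq nz_q => /eqP.
  rewrite !paddr_eq0 ?addr_ge0 ?sqr_ge0 // !sqrf_eq0.
  by case/andP=> /andP[/andP[/eqP-> /eqP->] /eqP->] /eqP->.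
exists (a / n, - b / n, - c / n, - d / n).
by split; congr (_, _, _, _); rewrite /= /n; field.
Qed.

Definition quat_comb (V : lmodType rat) (u i j k : V) (q : quatQ) : V :=
  let: (a, b, c, d) := q in a *: u + b *: i + c *: j + d *: k.

Section QuaternionTable.

Variables (gT : finGroupType) (u i j : gralg rat gT).
Hypotheses (uu : u * u = u) (ui : u * i = i) (iu : i * u = i).
Hypotheses (uj : u * j = j) (ju : j * u = j).
Hypotheses (ii : i * i = - u) (jj : j * j = - u) (ji : j * i = - (i * j)).

Local Notation phi := (quat_comb u i j (i * j)).

Lemma quat_comb_zmod : zmod_morphism phi.
Proof.
move=> [[[a b] c] d] [[[a' b'] c'] d']; rewrite /quat_comb /=.
by apply/ffunP=> g; rewrite !ffunE; ring.
Qed.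

Lemma quat_combM : {morph phi : q r / q * r}.
Proof.
have [k Dk] : exists k, k = i * j by exists (i * j).
have uk : u * k = k by rewrite Dk mulrA ui.
have ku : k * u = k by rewrite Dk -mulrA ju.
have ik : i * k = - j by rewrite Dk mulrA ii mulNr uj.
have ki : k * i = j by rewrite Dk -mulrA ji mulrN mulrA ii mulNr uj opprK.
have kj : k * j = - i by rewrite Dk -mulrA jj mulrN iu.
have jk : j * k = i by rewrite Dk mulrA ji mulNr -mulrA jj mulrN iu opprK.
have kk : k * k = - u by rewrite {1}Dk -mulrA jk ii.
move=> [[[a b] c] d] [[[a' b'] c'] d'].
rewrite -Dk /quat_comb /= !mulrDl !mulrDr -!gscalerAl -!gscalerAr.
rewrite uu ui iu uj ju ii jj ji uk ku ik ki kj jk kk -Dk.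
by apply/ffunP=> g; rewrite !ffunE; ring.
Qed.

Lemma quat_comb1 : phi 1 = u.
Proof. by rewrite /quat_comb /= scale1r !scale0r !addr0. Qed.

End QuaternionTable.

(** * The corner rings *)

Section CyclotomicCorner.

Variables (gT : finGroupType) (Z : {group gT}) (mu : Iirr Z).
Hypothesis abelZ : abelian Z.

Local Notation N := [group of cfker 'chi_mu].
Local Notation e := (epsilon rat Z N).
Local Notation d := #|(Z / N)%g|.
Local Notation K := (cyclotomic_field d).

Lemma cyclotomic_embedding m : (0 < m)%N ->
  exists (iota : {rmorphism cyclotomic_field m -> algC})
    (z : cyclotomic_field m),
    m.-primitive_root z /\ <<1; z>>%VS = fullv.
Proof.
case: m => // m _; rewrite /cyclotomic_field.
case: (C_prim_root_exists _) => /= w prim_w.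
case: (num_field_exists _) => L [LC [[|z []] //= [Dz] genL]].
exists LC, z; split; last by rewrite -genL span_seq1.
by rewrite -Dz fmorph_primitive_root in prim_w.
Qed.

Lemma poly_in_Fadjoin (L : fieldExtType rat) (z a : L) : <<1; z>>%VS = fullv ->
  exists q : {poly rat}, a = (map_poly (in_alg L) q).[z].
Proof.
move=> genL; have: a \in <<1; z>>%VS by rewrite genL memvf.
by case/Fadjoin_polyP=> p /polyOver1P[q ->] ->; exists q.
Qed.

Lemma gev_aut (u : {rmorphism algC -> algC}) j l (x : gralg rat gT) :
    {in Z, forall z, u ('chi[Z]_j z) = 'chi[Z]_l z} ->
  gev Z 'chi_l (gralgQC x) = u (gev Z 'chi_j (gralgQC x)).
Proof.
move=> Du; rewrite rmorph_sum; apply: eq_bigr => z Zz.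
by rewrite rmorphM /= Du // ffunE fmorph_rat.
Qed.

(** Evaluation at [mu] identifies [QZ e] with the cyclotomic field: it is
    injective there because the other characters that do not vanish on [e] are
    Galois conjugates of [mu]. *)
Lemma cyclotomic_component : exists psi : {additive K -> gralg rat gT},
  [/\ {morph psi : a b / a * b}, psi 1 = e, forall a, psi a \in gralg_on Z
    & forall x, x \in gralg_on Z -> exists a, psi a = x * e].
Proof.
have sNZ : N \subset Z := cfker_sub _.
have Ze := epsilon_on sNZ; have ee := epsilon_idem abelZ sNZ.
have [iota [z [prim_z genK]]] := cyclotomic_embedding (cardG_gt0 (Z / N)%G).
have [z1 [Zz1 genZ prim1]] := cfker_generator abelZ mu.
have {}prim1 := prim1 mu erefl.
have prim_w : d.-primitive_root (iota z) by rewrite fmorph_primitive_root.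
have [k Dk] := prim_rootP prim1 (prim_expr_order prim_w).
have [l Dl] := prim_rootP prim_w (prim_expr_order prim1).
pose ev x := gev Z 'chi_mu (gralgQC x).
have ev_e : ev e = 1 by rewrite /ev gev_epsilonQ ?eqxx.
have evM x y : x \in gralg_on Z -> y \in gralg_on Z -> ev (x * y) = ev x * ev y.
  by move=> Zx Zy; rewrite /ev rmorphM /= gev_irrM ?gralgQC_on.
(* The characters that do not vanish on [e] have kernel [N], hence are
   conjugates of [mu]. *)
have ev_inj x y : x \in gralg_on Z -> y \in gralg_on Z ->
    x * e = x -> y * e = y -> ev x = ev y -> x = y.
  move=> Zx Zy <- <-; rewrite /ev !gev_epsilonM // eqxx !mulr1 => eq_ev.
  apply: (gralg_center_ext abelZ); rewrite ?gralg_onM // => j.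
  rewrite !gev_epsilonM //; case: eqP => [kerj | _]; last by rewrite !mulr0.
  have [u [k' Du]] := cfker_conjugate abelZ kerj.
  have Dj : {in Z, forall z, u ('chi_mu z) = 'chi_j z} by move=> g /Du[].
  by rewrite !(gev_aut _ Dj) eq_ev.
have evZ q x : ev (q *: x) = ratr q * ev x by rewrite /ev gralgQCZ gevZ.
have ev_base g : g \in Z -> ev (gbase rat g) = 'chi_mu g.
  by move=> Zg; rewrite /ev gralgQC_base gev_base.
have ev_surj a : exists x : gralg rat gT,
    [&& x \in gralg_on Z, x * e == x & ev x == iota a].
  have [q ->] := poly_in_Fadjoin a genK.
  pose x : gralg rat gT := \sum_(i < size q) q`_i *: gbase rat (z1 ^+ (k * i))%g.
  have Zx : x \in gralg_on Z.
    by apply: gralg_on_bigsum => i _; rewrite gralg_onZ ?gralg_on_base ?groupX.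
  exists (x * e); rewrite gralg_onM // -mulrA ee eqxx evM // ev_e mulr1 /=.
  apply/eqP; rewrite horner_coef size_map_poly rmorph_sum /ev !raddf_sum /=.
  apply: eq_bigr => i _; rewrite -[LHS]/(ev _) evZ ev_base ?groupX //.
  rewrite coef_map /= rmorphM rmorphXn /= Dk lin_charX ?abel_lin //.
  by rewrite alg_num_field fmorph_rat -exprM.
pose psi a := sval (sigW (ev_surj a)).
have psiP a : [/\ psi a \in gralg_on Z, psi a * e = psi a & ev (psi a) = iota a].
  by rewrite /psi; case: (sigW _) => x /= /and3P[? /eqP? /eqP?].
have psi_zmod : zmod_morphism psi.
  move=> a b; have [Zab eab vab] := psiP (a - b).
  have [Za ea va] := psiP a; have [Zb eb vb] := psiP b.
  apply: ev_inj; rewrite ?gralg_onD ?gralg_onN ?mulrBl ?ea ?eb //.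
  by rewrite vab /ev !raddfB /= -va -vb.
pose psiA : {additive K -> gralg rat gT} :=
  HB.pack psi (GRing.isZmodMorphism.Build _ _ psi psi_zmod).
exists psiA; split=> [a b | | a | x Zx] /=.
- have [Zab eab vab] := psiP (a * b).
  have [Za ea va] := psiP a; have [Zb eb vb] := psiP b.
  by apply: ev_inj; rewrite ?gralg_onM -?mulrA ?eb // vab evM // va vb rmorphM.
- have [Z1 e1 v1] := psiP 1; apply: ev_inj => //.
  by rewrite v1 ev_e rmorph1.
- by case: (psiP a).
(* The values of [mu] are powers of the image of the generator [z]. *)
have [a Da] : exists a, iota a = ev (x * e).
  rewrite evM // ev_e mulr1 /ev /gev.
  elim/big_rec: _ => [|g c Zg [a <-]]; first by exists 0; rewrite rmorph0.
  have [i Di] := genZ g Zg; exists (ratr (x g) * z ^+ (l * i) + a).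
  by rewrite rmorphD rmorphM rmorphXn /= fmorph_rat ffunE Di // Dl exprM.
exists a; have [Za ea va] := psiP a.
by apply: ev_inj; rewrite ?gralg_onM // -?mulrA ?ee // va.
Qed.

End CyclotomicCorner.

Section CornerRings.

Variables (gT : finGroupType) (G : {group gT}) (mu : Iirr 'Z(G)).

Local Notation Z := ('Z(G))%G.
Local Notation N := [group of cfker 'chi_mu].
Local Notation e := (epsilon rat Z N).

Hypothesis derG : G^`(1)%g \subset 'Z(G).
Hypothesis nondegenerate :
  {in G, forall x, {in G, forall g, [~ x, g]%g \in N} -> x \in 'Z(G)}.

Variable Y : {group gT}.
Hypothesis isoY : isotropic mu Y.

Local Notation C := (orthogonal_group mu Y).
Local Notation f := (isotropic_idem mu Y).

Let abelZ : abelian Z := center_abelian G.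
Let sNZ : N \subset Z := ker_sub_center mu.
Let sZG : Z \subset G := center_sub G.
Let sYG : Y \subset G. Proof. by case/and3P: isoY. Qed.
Let sCG : C \subset G. Proof. exact: orthogonal_sub. Qed.
Let sZC : Z \subset C. Proof. exact: center_orthogonal. Qed.
Let Gf : f \in gralg_on G := isotropic_idem_on isoY.
Let ff : f * f = f := isotropic_idemK isoY.
Let ef : e * f = f := mul_epsilon_idem isoY.

Lemma epsilon_neq0 : e != 0.
Proof.
apply/eqP=> e0; have := gev_epsilonQ abelZ sNZ mu.
by rewrite e0 !raddf0 eqxx => /eqP; rewrite eq_sym oner_eq0.
Qed.

Lemma isotropic_idem_neq0 : f != 0.
Proof.
apply/eqP=> f0; have := sum_conj_isotropic_idem derG nondegenerate isoY.
rewrite f0 big1 => [/eqP|g _]; last by rewrite mulr0 mul0r.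
by rewrite eq_sym scaler_eq0 (negPf epsilon_neq0) orbF pnatr_eq0 eqn0Ngt cardG_gt0.
Qed.

Lemma gralg_center_commute (x y : gralg rat gT) :
  x \in gralg_on Z -> y \in gralg_on G -> x * y = y * x.
Proof.
move=> Zx Gy; rewrite (gralg_on_commute _ Gy) // => g Gg.
apply: gbase_commute_on Zx => z Zz; exact: center_commute Zz Gg.
Qed.

Lemma cyclotomic_component_iso : C = (Y * 'Z(G))%g :> {set gT} ->
  QG_component_iso G e 'M[cyclotomic_field #|(Z / N)%g|]_(#|G : C|%g).
Proof.
move=> defC; have [psi [psiM psi1 Zpsi psi_surj]] := cyclotomic_component mu abelZ.
have Gpsi a : psi a \in gralg_on G by apply: gralg_onS sZG (Zpsi a).
pose phi a := psi a * f.
have phi_zmod : zmod_morphism phi by move=> a b; rewrite /phi raddfB mulrBl.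
pose phiA : {additive cyclotomic_field #|(Z / N)%g| -> gralg rat gT} :=
  HB.pack phi (GRing.isZmodMorphism.Build _ _ phi phi_zmod).
have phiM : {morph phiA : a b / a * b}.
  move=> a b /=; rewrite /phi psiM -!mulrA; congr (_ * _).
  by rewrite mulrA -(gralg_center_commute (Zpsi b)) // -mulrA ff.
have phi1 : phiA 1 = f by rewrite /= /phi psi1.
apply: (isotropic_component_iso derG nondegenerate isoY phiM) => //.
- move=> a b /eqP; rewrite -subr_eq0 -raddfB => ab0; apply/eqP; rewrite -subr_eq0.
  apply: contraTT ab0 => nz_ab; apply: contra_neq isotropic_idem_neq0 => ab0.
  by rewrite -phi1 -(mulVf nz_ab) phiM ab0 mulr0.
- by move=> a; rewrite /= gralg_onM.
move=> c q; rewrite defC => /mulsgP[y z Yy Zz ->].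
have [|a Da] := psi_surj (q *: gbase rat z).
  by rewrite gralg_onZ ?gralg_on_base.
exists a; rewrite /= /phi Da -mulrA ef -gscalerAl gbaseM.
rewrite -mulrA (isotropic_commute isoY) ?(subsetP sZC) // mulrA.
by rewrite (gbase_isotropic _ Yy).
Qed.

Section QuaternionCorner.

Hypothesis oZN : #|(Z / N)%g| = 2%N.

(** Since [z ^+ 2] lies in [N], the vector [w + z w] is fixed by [z], hence
    killed by [e]. *)
Lemma gbase_center_opp z (w : gralg rat gT) : z \in 'Z(G) :\: N -> e * w = w ->
  gbase rat z * w = - w.
Proof.
move=> ZNz ew; have [Zz _] := setDP ZNz.
have Nz2 : (z ^+ 2)%g \in N.
  have nNz := subsetP (ker_norm mu) z (subsetP sZG z Zz).
  apply: coset_idr; first by rewrite groupX.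
  by rewrite morphX //= -oZN expg_cardG // mem_quotient.
apply/eqP; rewrite -addr_eq0 addrC; apply/eqP; set v := _ + _.
have ez : e * gbase rat z = gbase rat z * e.
  by rewrite (epsilon_gbase_commute _ (subsetP sZG z Zz)).
have <-: e * v = v by rewrite /v mulrDr mulrA ez -mulrA ew.
apply: (epsilon_fixed0 abelZ sNZ ZNz).
rewrite /v mulrDr mulrA -gbaseM addrC; congr (_ + _).
by rewrite -[in LHS]ew mulrA (gbase_epsilon abelZ sNZ).
Qed.

Variables x y : gT.
Hypotheses (Cx : x \in C) (Cy : y \in C).
Hypothesis x2 : exists2 z, z \in 'Z(G) :\: N & (x ^+ 2 * z^-1)%g \in Y.
Hypothesis y2 : exists2 z, z \in 'Z(G) :\: N & (y ^+ 2 * z^-1)%g \in Y.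
Hypothesis xy : [~ x, y]%g \in 'Z(G) :\: N.

Definition quat_embedding : quatQ -> gralg rat gT :=
  quat_comb f (gbase rat x * f) (gbase rat y * f)
    (gbase rat x * f * (gbase rat y * f)).
Local Notation phi := quat_embedding.

Lemma mul_corner g c : c \in C ->
  gbase rat g * f * (gbase rat c * f) = gbase rat (g * c)%g * f.
Proof.
move=> Cc; rewrite mulrA -(mulrA _ f) -(isotropic_commute isoY Cc).
by rewrite mulrA -gbaseM -mulrA ff.
Qed.

Lemma corner_sqr g : g \in C ->
    (exists2 z, z \in 'Z(G) :\: N & (g ^+ 2 * z^-1)%g \in Y) ->
  gbase rat g * f * (gbase rat g * f) = - f.
Proof.
move=> Cg [z ZNz Yg]; rewrite mul_corner // -(mulgKV z (g * g)%g) gbaseM -mulrA.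
by rewrite (gbase_center_opp ZNz) // mulrN (gbase_isotropic _ Yg).
Qed.

Lemma quat_embeddingM : {morph phi : q r / q * r}.
Proof.
have fC c : c \in C -> f * (gbase rat c * f) = gbase rat c * f.
  by move=> Cc; rewrite mulrA -(isotropic_commute isoY Cc) -mulrA ff.
apply: quat_combM; rewrite ?fC -?mulrA ?ff //; rewrite ?mulrA.
- by rewrite -mulrA corner_sqr.
- by rewrite -mulrA corner_sqr.
rewrite -!mulrA !(mulrA (gbase rat _)) !mul_corner //.
have ZNyx : [~ y, x]%g \in 'Z(G) :\: N.
  by rewrite -invg_comm; move: xy; rewrite !in_setD !groupV.
by rewrite (commgC y x) gbaseM -mulrA (gbase_center_opp ZNyx) // mulrN.
Qed.

Lemma quat_embedding1 : phi 1 = f.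
Proof. exact: quat_comb1. Qed.

HB.instance Definition _ := GRing.isZmodMorphism.Build _ _ phi
  (quat_comb_zmod f (gbase rat x * f) (gbase rat y * f)).

Lemma quat_embedding_on q : phi q \in gralg_on G.
Proof.
have Gb c : c \in C -> gbase rat c \in gralg_on G.
  by move=> Cc; rewrite gralg_on_base // (subsetP sCG).
case: q => [[[a b] c] d]; rewrite /quat_embedding /quat_comb.
by do 3?apply: gralg_onD; apply: gralg_onZ; rewrite ?gralg_onM ?Gb.
Qed.

Hypothesis decC : {in C, forall c, exists (a b : bool), exists2 t,
  t \in (Y * 'Z(G))%g & c = (x ^+ a * y ^+ b * t)%g}.

Lemma quaternion_component_iso :
  QG_component_iso G e 'M[quatQ]_(#|G : C|%g).
Proof.
apply: (isotropic_component_iso derG nondegenerate isoY (phi := phi)).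
- exact: quat_embeddingM.
- move=> q r /eqP; rewrite -subr_eq0 -raddfB => qr0; apply/eqP; rewrite -subr_eq0.
  apply: contraTT qr0 => /quat_inverse[s [sq _]].
  apply: contra_neq isotropic_idem_neq0 => qr0.
  by rewrite -quat_embedding1 -sq quat_embeddingM qr0 mulr0.
- exact: quat_embedding1.
- exact: quat_embedding_on.
move=> c q Cc; have [a [b [_ /mulsgP[y' z Yy' Zz ->] ->]]] := decC Cc.
have [s Ds] : exists s : rat, gbase rat (y' * z)%g * f = s *: f.
  rewrite gbaseM -mulrA; have [Nz | nNz] := boolP (z \in N).
    exists 1; rewrite scale1r -ef (mulrA (gbase rat z)).
    by rewrite (gbase_epsilon abelZ sNZ) // ef (gbase_isotropic _ Yy').
  have ZNz : z \in 'Z(G) :\: N by rewrite in_setD nNz.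
  exists (-1); rewrite (gbase_center_opp ZNz) //.
  by rewrite mulrN (gbase_isotropic _ Yy') scaleN1r.
rewrite gbaseM -mulrA Ds -gscalerAr scalerA.
case: a b => [] [] /=.
- exists (0, 0, 0, q * s); rewrite /= /quat_embedding /quat_comb !scale0r !add0r.
  by rewrite mul_corner // !expg1.
- exists (0, q * s, 0, 0); rewrite /= /quat_embedding /quat_comb !scale0r.
  by rewrite !addr0 add0r expg0 expg1 mulg1.
- exists (0, 0, q * s, 0); rewrite /= /quat_embedding /quat_comb !scale0r.
  by rewrite !addr0 !add0r expg0 expg1 mul1g.
exists (q * s, 0, 0, 0); rewrite /= /quat_embedding /quat_comb !scale0r !addr0.
by rewrite mulg1 gbase1 mul1r.
Qed.

End QuaternionCorner.

End CornerRings.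

(** * Multiplicities in rational representations *)

(** A full rank factorization of an idempotent [A = U *m V] satisfies
    [V *m U = 1], and the trace does not see the order of the factors. *)
Lemma mxtrace_idem (F : fieldType) n (A : 'M[F]_n) : A *m A = A ->
  \tr A = (\rank A)%:R.
Proof.
have [L LC] := row_fullP (col_base_full A).
have [R BR] := row_freeP (row_base_free A).
move: (\rank A) (col_base A) (row_base A) (mulmx_base A) L R LC BR.
move=> r U V defA L R LU VR AA.
suff VU : V *m U = 1%:M by rewrite -{1}defA mxtrace_mulC VU mxtrace1.
have: L *m (A *m A) *m R = L *m A *m R by rewrite AA.
by rewrite -defA !mulmxA LU !mul1mx -!mulmxA VR mulmx1.
Qed.

Section SchurIndex.

Variables (gT : finGroupType) (G : {group gT}) (mu : Iirr 'Z(G)) (i : Iirr G).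
Hypothesis chi_mu : 'chi_i =1 chi_of mu.

Local Notation Z := ('Z(G))%G.
Local Notation N := [group of cfker 'chi_mu].
Local Notation e := (epsilon rat Z N).

Hypothesis derG : G^`(1)%g \subset 'Z(G).
Hypothesis nondegenerate :
  {in G, forall x, {in G, forall g, [~ x, g]%g \in N} -> x \in 'Z(G)}.

Variable Y : {group gT}.
Hypothesis isoY : isotropic mu Y.

Local Notation C := (orthogonal_group mu Y).
Local Notation f := (isotropic_idem mu Y).
Local Notation eps := (pcidem G 'chi_i).
Local Notation feps := (gralgQC f * eps)%R.

Let abelZ : abelian Z := center_abelian G.
Let sNZ : N \subset Z := ker_sub_center mu.
Let sZG : Z \subset G := center_sub G.
Let sYG : Y \subset G. Proof. by case/and3P: isoY. Qed.
Let sNY : N \subset Y. Proof. by case/and3P: isoY. Qed.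
Let sCG : C \subset G. Proof. exact: orthogonal_sub. Qed.
Let sZC : Z \subset C. Proof. exact: center_orthogonal. Qed.
Let Gf : f \in gralg_on G := isotropic_idem_on isoY.
Let GfC : gralgQC f \in gralg_on G := gralgQC_on Gf.

Lemma eps_on : eps \in gralg_on Z.
Proof. by apply: pcidem_on_center => g nZg; apply: chi_off_center. Qed.

Lemma gev_eps j : gev Z 'chi_j eps = (j == mu)%:R.
Proof.
apply: gev_pcidem => [z Zz | g nZg]; first exact: chi_center.
exact: chi_off_center.
Qed.

Let Geps : eps \in gralg_on G := gralg_onS sZG eps_on.

Lemma eps_idem : eps * eps = eps.
Proof.
apply: (gev_irr_ext abelZ); rewrite ?gralg_onM ?eps_on // => j.
by rewrite gev_irrM ?eps_on // !gev_eps -natrM mulnb andbb.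
Qed.

Lemma gbase_eps z : z \in 'Z(G) -> gbase algC z * eps = 'chi_mu z *: eps.
Proof.
move=> Zz; have Zb : gbase algC z \in gralg_on Z by apply: gralg_on_base.
apply: (gev_irr_ext abelZ) => [||j]; first by rewrite gralg_onM ?eps_on.
  exact/gralg_onZ/eps_on.
rewrite gev_irrM ?eps_on // (gevZ _ _ ('chi_mu z)) !gev_eps gev_base //.
by case: eqP => [-> // | _]; rewrite !mulr0.
Qed.

Lemma epsilon_eps : gralgQC e * eps = eps.
Proof.
have Ze : gralgQC e \in gralg_on Z by rewrite gralgQC_on ?epsilon_on.
apply: (gev_irr_ext abelZ); rewrite ?gralg_onM ?eps_on // => j.
rewrite gev_irrM ?eps_on // gev_epsilonQ // !gev_eps -natrM mulnb.
by case: (j =P mu) => [-> | _]; rewrite ?eqxx ?andbF.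
Qed.

Lemma isotropic_eps : feps = hat algC Y * eps.
Proof.
by rewrite isotropic_idemE rmorphM /= -mulrA epsilon_eps gralgQC_hat.
Qed.

Lemma eps_commute g : g \in G -> gbase algC g * eps = eps * gbase algC g.
Proof.
move=> Gg; apply: gbase_commute_on eps_on => z Zz.
exact: center_commute Zz Gg.
Qed.

Lemma eps_central x : x \in gralg_on G -> x * eps = eps * x.
Proof. exact/gralg_on_commute/eps_commute. Qed.

Lemma isotropic_eps_idem : feps * feps = feps.
Proof.
rewrite mulrA -(mulrA _ eps) -(eps_central GfC) mulrA -rmorphM /=.
by rewrite (isotropic_idemK isoY) -mulrA eps_idem.
Qed.

Variables (n : nat) (rG : mx_representation rat G n) (m : nat).

Local Notation rC := (map_repr (ratr : rat -> algC) rG).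
Local Notation psi := (cfRepr rC).

Hypothesis irrG : mx_irreducible rG.
Hypothesis mult_m : '[psi, 'chi_i] = m%:R.

Lemma trace_eps : \tr (grho rC eps) = 'chi_i 1%g * m%:R.
Proof.
rewrite grhoZ linearZ /= [grho _ _]raddf_sum [\tr _]raddf_sum /=.
rewrite -mult_m cfdotE mulrA.
congr (_ * _); rewrite (reindex_inj invg_inj) /=.
apply: eq_big => [g | g]; rewrite groupV // => Gg.
rewrite grhoZ linearZ /= invgK grho_base // irr_inv mulrC cfunE Gg mulr1n.
by [].
Qed.

(** For [y] in [Y] but not in [N], some conjugate of [y eps] is
    [mu z *: (y eps)] with [mu z != 1], so that its trace is zero; only the
    elements of [N] contribute. *)
Lemma trace_isotropic_eps :
  \tr (grho rC feps) * #|Y|%:R = 'chi_i 1%g * m%:R * #|N|%:R.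
Proof.
rewrite isotropic_eps -gscalerAl grhoZ linearZ /= mulrAC mulVf ?mul1r; last first.
  by rewrite pnatr_eq0 -lt0n cardG_gt0.
rewrite mulr_suml [grho _ _]raddf_sum [\tr _]raddf_sum /=.
rewrite (big_setID N) /= [X in _ + X]big1 ?addr0 => [|y /setDP[Yy nNy]]; last first.
  have Gy := subsetP sYG y Yy.
  have [h Gh nNz] := isotropic_not_orthogonal nondegenerate isoY Yy nNy.
  have Zz := comm_center derG Gy Gh; set z := [~ y, h]%g in nNz Zz.
  have Gb g : g \in G -> gbase algC g \in gralg_on G by apply: gralg_on_base.
  have hh : grho rC (gbase algC h) *m grho rC (gbase algC h^-1%g) = 1%:M.
    by rewrite -grhoM ?Gb ?groupV // -gbaseM mulgV grho_base // repr_mx1.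
  (* Conjugation by [h] turns [y eps] into [y z eps = mu z *: (y eps)]. *)
  set t := \tr _; have: t = 'chi_mu z * t.
    rewrite {2}/t -linearZ /= -grhoZ gscalerAr -gbase_eps // mulrA -gbaseM.
    have ->: (y * z = h^-1 * y * h)%g by rewrite /z commgEl mulKVg conjgE mulgA.
    rewrite 2!gbaseM -(mulrA _ (gbase algC h)) eps_commute // mulrA.
    rewrite -(mulrA (gbase algC h^-1%g)).
    rewrite !grhoM ?gralg_onM ?Gb ?groupV // mxtrace_mulC.
    by rewrite !mulmxA hh mul1mx -grhoM ?Gb.
  move/eqP; rewrite -subr_eq0 -{1}[t]mul1r -mulrBl mulf_eq0 subr_eq0 eq_sym.
  by rewrite -(mem_cfker_lin abelZ) ?(negPf nNz) // => /eqP.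
rewrite (setIidPr sNY) (eq_bigr (fun=> 'chi_i 1%g * m%:R)) => [|y Ny].
  by rewrite sumr_const -[LHS]mulr_natr.
have Zy := subsetP sNZ y Ny; move: Ny; rewrite mem_cfker_lin // => /eqP mu_y.
by rewrite gbase_eps // mu_y scale1r trace_eps.
Qed.

Lemma rank_isotropic_eps :
  (\rank (grho rC feps) * #|Y|)%:R = 'chi_i 1%g * m%:R * #|N|%:R.
Proof.
rewrite natrM -mxtrace_idem ?trace_isotropic_eps //.
by rewrite -grhoM ?isotropic_eps_idem ?gralg_onM.
Qed.

Hypothesis m_gt0 : (0 < m)%N.

Lemma rank_isotropic_neq0 : grho rC feps != 0.
Proof.
apply/eqP=> fe0; have := rank_isotropic_eps; rewrite fe0 mxrank0 mul0n => /esym/eqP.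
by rewrite !mulf_eq0 (negPf (irr1_neq0 i)) !pnatr_eq0 !eqn0Ngt m_gt0 cardG_gt0.
Qed.

(** The trace computation shows that [f eps], hence [f], does not act as zero;
    the rows of its matrix are fixed by [f]. *)
Lemma isotropic_fixed_vector : exists2 v : 'rV[rat]_n, v != 0 & v *m grho rG f = v.
Proof.
have ff := isotropic_idemK isoY.
have nz_f : grho rG f != 0.
  apply: contraNneq rank_isotropic_neq0 => f0.
  by rewrite grhoM ?gralg_onM // grho_gralgQC f0 map_mx0 mul0mx.
have [_ /submxP[u ->] nz_uf] := rowV0Pn nz_f.
by exists (u *m grho rG f); rewrite // -mulmxA -grhoM ?ff.
Qed.

(** A non-zero rational vector [v] fixed by [f] generates the irreducible
    representation. When [C] is [Y * Z], the elements [f x f] act on the image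
    of [f eps] by scalars, since [Y] acts trivially there and the center acts
    through [mu]; hence the image of [v] spans it. *)
Lemma schur_index_split : C = (Y * 'Z(G))%g :> {set gT} ->
  (\rank (grho rC feps) <= 1)%N.
Proof.
move=> defC; have [v nz_v vf] := isotropic_fixed_vector.
have ff := isotropic_idemK isoY.
pose w := map_mx (ratr : rat -> algC) v *m grho rC feps.
suff /mxrankS : (grho rC feps <= w)%MS.
  by move/leq_trans; apply; apply: rank_leq_row.
apply/row_subP=> j; rewrite rowE; set u := delta_mx _ _.
have [A /envelop_mxP[a DA] Du] : exists2 A : 'M[rat]_n,
    (A \in enveloping_algebra_mx rG)%MS & delta_mx 0 j = v *m A.
  by apply/cyclic_mxP; rewrite -(mxsimple_cyclic irrG) ?submx1.
pose x : gralg rat gT := \sum_(g in G) a g *: gbase rat g.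
have Gx : x \in gralg_on G.
  by apply: gralg_on_bigsum => g Gg; rewrite gralg_onZ ?gralg_on_base.
have {DA} DA : A = grho rG x.
  rewrite DA raddf_sum; apply: eq_bigr => g Gg.
  by rewrite /= grhoZ grho_base.
have -> : u = map_mx (ratr : rat -> algC) v *m grho rC (gralgQC (f * x)).
  rewrite grho_gralgQC -map_mxM /= grhoM // mulmxA vf -DA -Du.
  by rewrite map_delta_mx.
rewrite -mulmxA -grhoM ?gralgQC_on ?gralg_onM ?gralgQC_on //.
rewrite mulrA -rmorphM /= (isotropic_sandwich derG isoY Gx).
(* For [c = y' * z] the product [c f eps] is [mu z *: (f eps)]. *)
have [s ->] : exists s, gralgQC (\sum_(c in C) x c *: (gbase rat c * f)) * eps =
    s *: feps.
  rewrite rmorph_sum mulr_suml; elim/big_rec: _ => [|c y Cc [s ->]].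
    by exists 0; rewrite scale0r.
  have := Cc; rewrite defC => /mulsgP[y' z Yy Zz Dc].
  exists (ratr (x c) * 'chi_mu z + s); rewrite scalerDl; congr (_ + _).
  have Gz := subsetP sZG z Zz.
  rewrite /= gralgQCZ -gscalerAl -[RHS]scalerA; congr (_ *: _).
  rewrite Dc -(center_commute Zz (subsetP sYG _ Yy)) gbaseM -mulrA.
  rewrite (gbase_isotropic _ Yy) (isotropic_commute isoY) ?(subsetP sZC) //.
  by rewrite rmorphM /= gralgQC_base -mulrA gbase_eps // -gscalerAr.
by rewrite grhoZ -scalemxAr scalemx_sub.
Qed.

Section QuaternionRepresentation.

Hypothesis oZN : #|(Z / N)%g| = 2%N.

Variables x y : gT.
Hypotheses (Cx : x \in C) (Cy : y \in C).
Hypothesis x2 : exists2 z, z \in 'Z(G) :\: N & (x ^+ 2 * z^-1)%g \in Y.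
Hypothesis y2 : exists2 z, z \in 'Z(G) :\: N & (y ^+ 2 * z^-1)%g \in Y.
Hypothesis xy : [~ x, y]%g \in 'Z(G) :\: N.

(** A linear character with kernel of index two takes the value [-1] off its
    kernel, so that [mu] is the only character with kernel [N]. *)
Lemma epsilon_eps_order2 : gralgQC e = eps.
Proof.
have Ze : gralgQC e \in gralg_on Z by rewrite gralgQC_on ?epsilon_on.
apply: (gev_irr_ext abelZ); rewrite ?eps_on // => j.
rewrite gev_epsilonQ // gev_eps; suff -> : (cfker 'chi_j == N) = (j == mu) by [].
apply/eqP/eqP=> [kerj | -> //].
have off_N (l : Iirr Z) z : cfker 'chi_l = N -> z \in 'Z(G) :\: N -> 'chi_l z = -1.
  move=> kerl /setDP[Zz nNz]; have linl := abel_lin abelZ l.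
  have : 'chi_l z ^+ 2 == 1.
    rewrite -lin_charX // -(mem_cfker_lin abelZ l (groupX 2 Zz)) kerl.
    have nNZ := subsetP (ker_norm mu) z (subsetP sZG z Zz).
    apply: coset_idr; first by rewrite groupX.
    by rewrite morphX //= -oZN expg_cardG // mem_quotient.
  rewrite sqrf_eq1 -(mem_cfker_lin abelZ) // kerl (negPf nNz) => /eqP //.
apply/irr_inj/cfun_inP=> z Zz; have [Nz | nNz] := boolP (z \in N).
  have /eqP-> : 'chi_mu z == 1 by rewrite -(mem_cfker_lin abelZ).
  by apply/eqP; rewrite -(mem_cfker_lin abelZ) // kerj.
by rewrite !off_N // in_setD nNz.
Qed.

(** The quaternions form a division ring, so that they act freely on a non-zero
    rational vector of the image of [f]. *)
Lemma schur_index_quaternion : (4 <= \rank (grho rC feps))%N.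
Proof.
have [v nz_v vf] := isotropic_fixed_vector.
have ff := isotropic_idemK isoY.
rewrite -epsilon_eps_order2 -rmorphM /= -(epsilon_central mu Gf).
rewrite (mul_epsilon_idem isoY) grho_gralgQC mxrank_map.
pose phi := quat_embedding mu Y x y.
have Gphi q : phi q \in gralg_on G by apply: quat_embedding_on.
have phif q : phi q * f = phi q.
  by rewrite -(quat_embedding1 mu Y x y) -quat_embeddingM ?mulr1.
pose I := gbase rat x * f; pose J := gbase rat y * f.
pose basis : seq (gralg rat gT) := [:: f; I; J; I * J].
pose M : 'M[rat]_(4, n) := \matrix_(j < 4) (v *m grho rG basis`_j).
have basisE (j : 'I_4) : exists q, basis`_j = phi q.
  case: j => [[|[|[|[|//]]]] lt_j]; rewrite /phi /quat_embedding /quat_comb /=.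
  - by exists (1, 0, 0, 0); rewrite scale1r !scale0r !addr0.
  - by exists (0, 1, 0, 0); rewrite scale1r !scale0r !addr0 add0r.
  - by exists (0, 0, 1, 0); rewrite scale1r !scale0r !addr0 !add0r.
  - by exists (0, 0, 0, 1); rewrite scale1r !scale0r !add0r.
have sMf : (M <= grho rG f)%MS.
  apply/row_subP=> j; rewrite rowK; have [q ->] := basisE j.
  by rewrite -phif grhoM // mulmxA submxMl.
suff freeM : row_free M.
  by move: freeM; rewrite /row_free => /eqP<-; apply: mxrankS.
rewrite -kermx_eq0; apply/rowV0P=> u /sub_kermxP uM0.
pose o1 : 'I_4 := lift ord0 ord0; pose o2 : 'I_4 := lift ord0 (lift ord0 ord0).
pose o3 : 'I_4 := lift ord0 (lift ord0 (lift ord0 ord0)).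
pose q : quatQ := (u 0 ord0, u 0 o1, u 0 o2, u 0 o3).
have uM : u *m M = v *m grho rG (phi q).
  rewrite mulmx_sum_row !big_ord_recl big_ord0 addr0 !rowK /=.
  by rewrite !scalemxAr -!mulmxDr -!grhoZ -!raddfD /= !addrA.
have q0 : q = 0.
  apply: contraNeq nz_v => /quat_inverse[r [_ qr]].
  rewrite -vf -(quat_embedding1 mu Y x y) -qr quat_embeddingM // grhoM //.
  by rewrite mulmxA -uM uM0 mul0mx.
case: q0 => u0 u1 u2 u3; apply/rowP=> j; rewrite mxE.
case: j => [[|[|[|[|//]]]] lt_j].
- by rewrite -[RHS]u0; congr (u 0 _); apply: val_inj.
- by rewrite -[RHS]u1; congr (u 0 _); apply: val_inj.
- by rewrite -[RHS]u2; congr (u 0 _); apply: val_inj.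
- by rewrite -[RHS]u3; congr (u 0 _); apply: val_inj.
Qed.

End QuaternionRepresentation.

End SchurIndex.

(** * VZ-groups *)

(** On a non-central element of the derived subgroup the non-linear characters
    vanish and the linear ones are one, which contradicts its orthogonality to
    the identity element. *)
Lemma VZ_group_der_center (gT : finGroupType) (G : {group gT}) :
  VZ_group G -> G^`(1)%g \subset 'Z(G).
Proof.
move=> VZ_G; apply/subsetP=> g G'g; apply: contraT => nZg.
have Gg := subsetP (der_sub 1 G) g G'g.
have := second_orthogonality_relation g (group1 G).
rewrite class1G inE; case: eqP nZg => [-> | _ nZg]; first by rewrite group1.
rewrite mulr0n => sum0.
have term (j : Iirr G) : 'chi_j g * ('chi_j 1%g)^* = ('chi_j \is a linear_char)%:R.
  have [linj | nlj] := boolP ('chi_j \is a linear_char).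
    have := subsetP (lin_char_der1 linj) g G'g.
    by rewrite cfkerEirr inE lin_char1 // => /eqP->; rewrite mul1r conjC1.
  rewrite VZ_G ?mul0r //; last by rewrite in_setD nZg.
  by rewrite inE; move: nlj; rewrite qualifE /= irr_char.
move: sum0; rewrite (eq_bigr _ (fun j _ => term j)) => /psumr_eq0P.
move=> /(_ (fun j _ => ler0n _ _) 0 isT) /eqP.
by rewrite irr0 cfun1_lin_char oner_eq0.
Qed.

Section VZCharacter.

Variables (gT : finGroupType) (G : {group gT}) (mu : Iirr 'Z(G)) (i : Iirr G).
Hypothesis chi_mu : 'chi_i =1 chi_of mu.

Local Notation Z := ('Z(G))%G.
Local Notation N := [group of cfker 'chi_mu].

Hypothesis derG : G^`(1)%g \subset 'Z(G).

Lemma vanishing_nondegenerate :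
  {in G, forall x, {in G, forall g, [~ x, g]%g \in N} -> x \in 'Z(G)}.
Proof.
move=> x Gx Nx; have defN := cfker_chi_mu chi_mu.
have nNG : G \subset 'N(cfker 'chi_i) by rewrite defN ker_norm.
have : coset (cfker 'chi_i) x \in 'Z(G / cfker 'chi_i)%g.
  rewrite inE mem_quotient //=; apply/centP=> _ /morphimP[g nNg Gg ->] /=.
  apply/commgP; rewrite -morphR //= ?(subsetP nNG) // coset_id //.
  by rewrite defN; apply: Nx.
rewrite -cfcenter_eq_center => /morphimP[y nNy Zy Dxy].
have {Dxy Zy} Zx : x \in 'Z('chi_i)%CF.
  rewrite -(quotientGK (cfker_center_normal 'chi_i)) morphpreE in_setI.
  by rewrite (subsetP nNG) //= inE Dxy mem_quotient.
apply: contraTT Zx => nZx; rewrite irr_cfcenterE //.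
by rewrite (chi_off_center chi_mu nZx) normr0 eq_sym irr1_neq0.
Qed.

(** In a nilpotent group a minimal normal subgroup is central. *)
Lemma epsilon_pgroup (p : nat) : p.-group G -> ~~ (Z \subset N) ->
  epsilon rat G N = epsilon rat Z N.
Proof.
move=> pG nZN; rewrite /epsilon.
have nNG := ker_norm mu; have sNZ := ker_sub_center mu.
have sZG : Z \subset G := center_sub G.
case: eqP => [GN | _]; first by rewrite -GN sZG in nZN.
case: eqP => [ZN | _]; first by rewrite ZN subxx in nZN.
have ZGN : 'Z(G / N)%g = (Z / N)%g.
  apply/eqP; rewrite eqEsubset; apply/andP; split; last first.
    by rewrite subsetI quotientS //= quotient_cents // subsetIr.
  apply/subsetP=> _ /setIP[/morphimP[x nNx Gx ->] /centP cx]; apply: mem_quotient.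
  apply: vanishing_nondegenerate => // g Gg; have nNg := subsetP nNG g Gg.
  apply: coset_idr; first exact: groupR.
  by rewrite morphR //=; apply/eqP/commgP/cx/mem_quotient.
have norm_central (H : {group coset_of N}) : H \subset (Z / N)%g ->
    (G / N)%g \subset 'N(H).
  by rewrite -ZGN => sHZ; rewrite cents_norm // centsC (subset_trans sHZ) ?subsetIr.
apply: eq_bigl => D; have [sND | //] := boolP (N \subset D); rewrite /=.
apply/andP/andP=> [[sDG] | [sDZ]] /mingroupP[/andP[ntD nD] minD].
  have nsD : (D / N <| G / N)%g by rewrite /normal quotientS.
  have sDZ : (D / N \subset Z / N)%g.
    have pGN : p.-group (G / N)%g by rewrite quotient_pgroup.
    have nilG := pgroup_nil pGN.
    have ntDZ := meet_center_nil nilG nsD ntD.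
    have := minD (D / N :&: 'Z(G / N))%G.
    rewrite ntDZ norm_central ?subsetIl; last by rewrite -ZGN subsetIr.
    by move=> /(_ isT isT) <-; rewrite -ZGN subsetIr.
  have sDZ' : D \subset Z by rewrite -(quotientSGK _ sNZ) // (subset_trans sDG).
  split=> //; apply/mingroupP; rewrite ntD (subset_trans (quotientS _ sZG)) //.
  split=> // H /andP[ntH _] sHD; apply: minD => //.
  by rewrite ntH norm_central // (subset_trans sHD).
split; first exact: subset_trans sDZ sZG.
have sDZ' : (D / N \subset Z / N)%g by apply: quotientS.
apply/mingroupP; rewrite ntD norm_central //; split=> // H /andP[ntH nHG] sHD.
by apply: minD => //; rewrite ntH (subset_trans (quotientS _ sZG)).
Qed.

Hypothesis nZN : ~~ (Z \subset N).

Local Notation n := (Nat.sqrt #|(G / 'Z(G))%g|).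

Lemma sqrt_indexE k : #|(G / 'Z(G))%g| = (k * k)%N -> n = k.
Proof. by move=> ->; apply: PeanoNat.Nat.sqrt_square. Qed.

Lemma irr1_index k : #|(G / 'Z(G))%g| = (k * k)%N -> 'chi_i 1%g = k%:R.
Proof.
move=> oGZ; rewrite (chi1_sqrt chi_mu) oGZ natrM -expr2 sqrCK //.
Qed.

(** The two cases for [C / Y] are told apart by the Schur index. If ['chi_i] has
    multiplicity [m] in an irreducible rational representation, then [f eps] has
    rank [m] in the cyclic case, where this rank is at most one, and rank
    [2 * m] in the quaternion case, where it is at least four. *)
Lemma VZ_pgroup_dichotomy (p : nat) : p.-group G ->
    [/\ QG_component_iso G (epsilon rat G N) 'M[cyclotomic_field #|(Z / N)%g|]_n
      & forall m, is_schur_indexQ i m -> (m <= 1)%N]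
 \/ [/\ p = 2%N, QG_component_iso G (epsilon rat G N) 'M[quatQ]_(n./2)
      & forall m, is_schur_indexQ i m -> m <> 1%N].
Proof.
move=> pG; rewrite (epsilon_pgroup pG nZN).
have nondeg := vanishing_nondegenerate.
have [Y maxY] := maximal_isotropic_exists mu.
have isoY := maxgroupp maxY.
have [_ sYG _] := and3P isoY.
set C := orthogonal_group mu Y; pose k := #|G : C|%g.
have oYC := card_isotropic derG nondeg isoY.
have oG : (#|C| * k = #|G|)%N by rewrite Lagrange ?orthogonal_sub.
have oGZ := card_center_index G.
have oY : (#|Y| = k * #|N|)%N.
  apply/eqP; rewrite -(eqn_pmul2r (cardG_gt0 C)) oYC -oG; apply/eqP.
  by rewrite -mulnA; ring.
have rankE m r : (r * #|Y|)%:R = 'chi_i 1%g * m%:R * #|N|%:R ->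
    forall l, #|(G / 'Z(G))%g| = (l * l)%N -> (r * k = l * m)%N.
  move=> rY l /irr1_index chi1; apply/eqP.
  rewrite -(eqn_pmul2r (cardG_gt0 N)) -mulnA -oY -(eqr_nat algC) rY chi1.
  by rewrite -!natrM.
have k_gt0 : (0 < k)%N by rewrite indexg_gt0.
have := maximal_isotropic_quotient derG isoY pG nZN maxY.
case=> [cycW | [p2 quatW]]; [left | right].
  have defC := orthogonal_cyclic derG nondeg isoY cycW.
  have oC : #|C| = (k * #|'Z(G)|)%N.
    apply/eqP; rewrite -(eqn_pmul2r (cardG_gt0 N)) /C defC.
    by rewrite (card_isotropic_center isoY) oY mulnAC.
  have oI : #|(G / 'Z(G))%g| = (k * k)%N.
    apply/eqP; rewrite -(eqn_pmul2r (cardG_gt0 Z)) oGZ -oG oC.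
    by rewrite mulnAC.
  rewrite (sqrt_indexE oI); split; first exact: cyclotomic_component_iso.
  move=> m [n1 [rG [irrG _ mult]]]; rewrite leqNgt; apply/negP=> m_gt1.
  have m_gt0 := ltnW m_gt1.
  have := schur_index_split chi_mu derG nondeg isoY irrG mult m_gt0 defC.
  have := rankE _ _ (rank_isotropic_eps chi_mu derG nondeg isoY mult) k oI.
  rewrite mulnC => /eqP; rewrite eqn_pmul2l // => /eqP->.
  by rewrite leqNgt m_gt1.
have [x [y [[Cx Cy] oZN oC [x2 y2 xy] decC]]] :=
  orthogonal_quaternion derG isoY quatW.
have oZ : #|'Z(G)| = (2 * #|N|)%N.
  rewrite -oZN card_quotient ?(subset_trans (center_sub G) (ker_norm mu)) //.
  by rewrite mulnC Lagrange ?ker_sub_center.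
have oI : #|(G / 'Z(G))%g| = (k.*2 * k.*2)%N.
  apply/eqP; rewrite -(eqn_pmul2r (cardG_gt0 Z)) oGZ -oG oC oY oZ.
  by apply/eqP; rewrite -!muln2; ring.
rewrite (sqrt_indexE oI) doubleK; split=> //.
  exact: (quaternion_component_iso derG nondeg isoY oZN Cx Cy x2 y2 xy decC).
move=> m [n1 [rG [irrG _ mult]]] m1; rewrite m1 in mult.
have := schur_index_quaternion chi_mu derG nondeg isoY mult isT oZN Cx Cy x2 y2 xy.
have := rankE _ _ (rank_isotropic_eps chi_mu derG nondeg isoY mult) _ oI.
by rewrite muln1 -mul2n => /eqP; rewrite eqn_pmul2r // => /eqP->.
Qed.

End VZCharacter.

(* |G / Z(G)| is a perfect square for a VZ-group, so Nat.sqrt is exact. *)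
Theorem theorem41 (gT : finGroupType) (G : {group gT})
  (VZ_G : VZ_group G)
  (mu : Iirr 'Z(G)) (mu_G' : mu \in Irr_over 'Z(G)%G G^`(1)%G)
  (i : Iirr G) (nl_i : i \in nl G) (chi_mu : 'chi_i =1 chi_of mu) :
  let N := [group of cfker 'chi_i] in
  let n := Nat.sqrt #|G / 'Z(G)|%g in
  let d := #|'Z(G) / N|%g in
  [/\ cfker 'chi_i = cfker 'chi_mu,
      pcidemQ i = gralgQC (epsilon rat 'Z(G)%G N),
      forall p : nat, prime p -> odd p -> p.-group G ->
        QG_component_iso G (epsilon rat G N) 'M[cyclotomic_field d]_n
    & 2.-group G ->
      (is_schur_indexQ i 1 ->
         QG_component_iso G (epsilon rat G N) 'M[cyclotomic_field d]_n) /\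
      (is_schur_indexQ i 2 ->
         QG_component_iso G (epsilon rat G N) 'M[quatQ]_(n./2))].
Proof.
move=> N n d; have derG := VZ_group_der_center VZ_G.
have nZN : ~~ ('Z(G) \subset cfker 'chi_mu).
  by move: mu_G'; rewrite inE; apply: contra; apply: subset_trans.
have defN : N = [group of cfker 'chi_mu].
  by apply: group_inj; apply: cfker_chi_mu.
have dich := VZ_pgroup_dichotomy chi_mu derG nZN.
split.
- exact: cfker_chi_mu.
- exact: pcidemQ_epsilon.
- move=> p _ odd_p pG; rewrite /d defN; have [[] // | [p2 _ _]] := dich p pG.
  by rewrite p2 in odd_p.
move=> pG; rewrite /d defN; have [[iso_K le1] | [_ iso_H not1]] := dich 2%N pG.
  by split=> // /le1.
by split=> // /not1.
Qed.
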